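(* Let $(A_\pi,R_\pi,S_\pi)_{\pi\in\Pi}$ be a collection of matrices, $A_\pi\in\mathbb{M}_r$, $R_\pi,S_\pi\in\mathbb{S}_r^+$, satisfying the following continuity condition: for all $\epsilon\in\,]0,1]$ and $\alpha\in\,]0,1[$ there exists $\delta>0$ such that for all $\pi\in B(\delta)$, $$\alpha S\le S_\pi\le\alpha^{-1}S,\qquad \alpha R\le R_\pi\le\alpha^{-1}R,\qquad \Vert A-A_\pi\Vert_2\le\epsilon .$$ Then there exists some $\delta>0$ such that for any $\pi\in B(\delta)$, any $t\ge0$ and any $Q\in\mathbb{S}_r^+$, $$\Vert\phi_{\pi,t}(Q)-\phi_t(Q)\Vert_2\le\left[\chi_1(\delta)+e^{-4\nu t}\chi_2(\delta,\Vert Q\Vert_2)\right]\gamma(\pi)$$ for some finite constants $\chi_1(\delta)$ and $\chi_2(\delta,\Vert Q\Vert_2)$ whose values depend only on $\delta$, respectively on $(\delta,\Vert Q\Vert_2)$ (the nominal system $(A,R,S)$ being fixed). In particular, for all $\pi\in B(\delta)$, $$\Vert P_\pi-P\Vert_2\le\chi_1(\delta)\,\gamma(\pi).$$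
   Context: Notation: $\mathbb{M}_r$ = real $r\times r$ matrices, $\mathbb{S}_r^+\subset\mathbb{S}_r$ = symmetric positive semi-definite (resp. symmetric) matrices, $\le$ = Loewner order, $'$ = transpose, $\Vert\cdot\Vert_2$ = spectral norm. Standing setting: $A\in\mathbb{M}_r$, $C$ is a real $r'\times r$ matrix, $R\in\mathbb{S}_r^+$ and $\Sigma\in\mathbb{S}_{r'}^+$ are positive definite, $S:=C'\Sigma^{-1}C$; the pair $(A,R^{1/2})$ is controllable and $(A,C)$ is observable. $\mathrm{Ricc}(Q)=AQ+QA'-QSQ+R$; $\phi_t(Q)$ solves $\partial_t\phi_t(Q)=\mathrm{Ricc}(\phi_t(Q))$, $\phi_0(Q)=Q$; $P$ is the unique positive definite solution of $\mathrm{Ricc}(P)=0$. $\Pi$ is a compact subset of the set of continuous mappings $\pi:\mathbb{S}_r^+\to\mathbb{S}_r^+$ equipped with the uniform norm $\Vert\pi_1-\pi_2\Vert=\sup_{Q\in\mathbb{S}_r^+}\Vert\pi_1(Q)-\pi_2(Q)\Vert_2$, and $B(\delta):=\{\pi\in\Pi:\Vert\pi-\mathrm{id}\Vert\le\delta\}$. $\phi_{\pi,t}$ is the flow of $\mathrm{Ricc}_\pi(Q)=A_\pi Q+QA_\pi'-QS_\pi Q+R_\pi$ (started at $Q$ at time $0$), $P_\pi$ is the unique positive definite solution of $\mathrm{Ricc}_\pi(P_\pi)=0$, and $\gamma(\pi):=\Vert A_\pi-A\Vert_2+\Vert R_\pi-R\Vert_2+\Vert S_\pi-S\Vert_2$.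 Rate $\nu$: writing $E_t(Q)$ for the solution of $\partial_tE_t(Q)=(A-\phi_t(Q)S)E_t(Q)$, $E_0(Q)=Id$, it is known that there are $\nu>0$ (depending only on $(A,R,S)$) and finite non-decreasing functions $\kappa_E,\kappa_\phi$ with $\Vert E_t(Q)\Vert_2\le\kappa_E(\Vert Q\Vert_2)e^{-2\nu t}$ and $\Vert\phi_t(Q_2)-\phi_t(Q_1)\Vert_2\le\kappa_\phi(\Vert Q_1\Vert_2,\Vert Q_2\Vert_2)e^{-2\nu t}\Vert Q_2-Q_1\Vert_2$; $\nu$ is this fixed rate. *)

(* Defs.v *)
From HB Require Import structures.
From mathcomp Require Import all_boot all_order all_algebra.
From mathcomp Require Import all_classical all_reals all_analysis.
Set Implicit Arguments.
Unset Strict Implicit.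
Unset Printing Implicit Defensive.
Import Order.TTheory GRing.Theory Num.Theory.
Import numFieldNormedType.Exports.
Local Open Scope classical_set_scope.
Local Open Scope ring_scope.

Section Matrices.
Context {K : realType}.

Definition l2norm n (x : 'cV[K]_n) : K := Num.sqrt (\sum_i x i ord0 ^+ 2).

(* The operator norm induced by the Euclidean norm. *)
Definition spectral_norm n (M : 'M[K]_n) : K :=
  sup [set l2norm (M *m x) | x in [set x : 'cV[K]_n | l2norm x <= 1]].

Definition qform n (M : 'M[K]_n) (x : 'cV[K]_n) : K :=
  (x^T *m M *m x) ord0 ord0.

Definition posdef n (M : 'M[K]_n) : Prop :=
  M^T = M /\ forall x : 'cV[K]_n, x != 0 -> 0 < qform M x.

Definition psd_cone n : set 'M[K]_n :=
  [set M | M^T = M /\ forall x : 'cV[K]_n, 0 <= qform M x].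

Definition loewner_le n (M N : 'M[K]_n) : Prop := psd_cone (N - M).

Definition controllable n m (A : 'M[K]_n) (B : 'M[K]_(n, m)) : Prop :=
  \rank (\mxrow_(k < n) (A ^+ k *m B)) = n.

Definition observable n m (A : 'M[K]_n) (C : 'M[K]_(m, n)) : Prop :=
  \rank (\mxcol_(k < n) (C *m A ^+ k)) = n.

End Matrices.

Section Riccati.
Context {K : realType} {n : nat}.
Implicit Types (A R S Q P : 'M[K]_n) (phi : K -> 'M[K]_n -> 'M[K]_n).

Definition ricc A R S Q : 'M[K]_n :=
  A *m Q + Q *m A^T - Q *m S *m Q + R.

(* [X] solves X' = F t X on [0, +oo[ with X 0 = X0.  The derivative is
   two-sided, hence asked for at t > 0 only; with continuity on [0, +oo[ and
   a continuous right-hand side this yields the right derivative at 0. *)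
Definition ode_solution (F : K -> 'M[K]_n -> 'M[K]_n) (X0 : 'M[K]_n)
    (X : K -> 'M[K]_n) : Prop :=
  [/\ X 0 = X0,
      {within [set t : K | 0 <= t], continuous X} &
      forall t : K, 0 < t -> is_derive t 1 X (F t (X t))].

Definition riccati_flow A R S phi : Prop :=
  forall Q, psd_cone Q -> ode_solution (fun _ => ricc A R S) Q (phi ^~ Q).

Definition riccati_fixpoint A R S P : Prop :=
  posdef P /\ ricc A R S P = 0.

Definition stability_rate A S phi (nu : K) : Prop :=
  0 < nu /\
  exists (E : K -> 'M[K]_n -> 'M[K]_n) (kE : K -> K) (kphi : K -> K -> K),
    [/\ forall Q, psd_cone Q ->
          ode_solution (fun t X => (A - phi t Q *m S) *m X) 1%:M (E ^~ Q),
        forall a b : K, 0 <= a -> a <= b -> kE a <= kE b,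
        forall a1 b1 a2 b2 : K, 0 <= a1 -> a1 <= b1 -> 0 <= a2 -> a2 <= b2 ->
          kphi a1 a2 <= kphi b1 b2,
        forall (t : K) Q, 0 <= t -> psd_cone Q ->
          spectral_norm (E t Q)
            <= kE (spectral_norm Q) * expR (- (2 * nu * t)) &
        forall (t : K) Q1 Q2, 0 <= t -> psd_cone Q1 -> psd_cone Q2 ->
          spectral_norm (phi t Q2 - phi t Q1)
            <= kphi (spectral_norm Q1) (spectral_norm Q2)
               * expR (- (2 * nu * t)) * spectral_norm (Q2 - Q1)].

End Riccati.

Section Mappings.
Context {K : realType} {n : nat}.

Definition cone_map := continuousType (@psd_cone K n) (@psd_cone K n).

(* Extended-real valued: the mappings are not assumed to be bounded. *)
Definition uniform_dist (pi1 pi2 : cone_map) : \bar K :=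
  ereal_sup [set (spectral_norm (\val (pi1 Q) - \val (pi2 Q)))%:E
            | Q in [set: @psd_cone K n]].

(* Compactness for the topology of uniform convergence on the whole cone.
   The library's uniformity on matrices comes from the entrywise maximum norm;
   that norm being equivalent to [spectral_norm], this is the topology
   of [uniform_dist]. *)
Section Compact.
Import ArrowAsUniformType.
Definition uniform_compact (Pi : set cone_map) : Prop := compact Pi.
End Compact.

Definition near_id (Pi : set cone_map) (delta : K) : set cone_map :=
  [set pi | Pi pi /\ (uniform_dist pi idfun <= delta%:E)%E].

Definition continuity_condition (A R S : 'M[K]_n) (Pi : set cone_map)
    (Api Rpi Spi : cone_map -> 'M[K]_n) : Prop :=
  forall epsilon alpha : K,
    0 < epsilon <= 1 -> 0 < alpha < 1 ->
    exists2 delta : K, 0 < delta &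
      forall pi, near_id Pi delta pi ->
        [/\ loewner_le (alpha *: S) (Spi pi) /\
              loewner_le (Spi pi) (alpha^-1 *: S),
            loewner_le (alpha *: R) (Rpi pi) /\
              loewner_le (Rpi pi) (alpha^-1 *: R) &
            spectral_norm (A - Api pi) <= epsilon].

Definition perturbation_size (A R S : 'M[K]_n)
    (Api Rpi Spi : cone_map -> 'M[K]_n) (pi : cone_map) : K :=
  spectral_norm (Api pi - A) + spectral_norm (Rpi pi - R)
  + spectral_norm (Spi pi - S).

End Mappings.
Arguments cone_map : clear implicits.

(* Main.v *)
(* All matrix inequalities are in the Loewner order. Since R > 0, the equation Ricc(P) = 0
   makes P itself a Lyapunov matrix for the closed loop, and completing the
   square gives Ricc(X) <= F X + X F' + (P S P + R) with F = A - P S. This bounds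
   every trajectory X of every nearby system by (c + m0 e^{-lambda t}) P, with c
   independent of the initial condition. For two trajectories X1, X2 of nearby systems,
   Ricc2(X1) - Ricc2(X2) <= (A2 - X2 S2) (X1 - X2) + (X1 - X2) (A2 - X2 S2)',
   whose closed loop dissipates X2 itself, because
   X2' = (A2 - X2 S2) X2 + X2 (A2 - X2 S2)' + X2 S2 X2 + R2.
   Hence X1 - X2 <= m X2 for a scalar m solving m' = - mu (m - a), with a
   proportional to the size of the perturbation; exchanging the two systems
   gives the lower bound. The rate mu depends on the initial condition, which is
   harmless: B e^{-mu t} <= 1 + e^{-4 nu t} chi2 for a suitable chi2. *)
Require Import Defs.
From HB Require Import structures.
From mathcomp Require Import all_boot all_order all_algebra.
From mathcomp Require Import all_classical all_reals all_analysis.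
From mathcomp Require Import ring lra.
Set Implicit Arguments.
Unset Strict Implicit.
Unset Printing Implicit Defensive.
Import Order.TTheory GRing.Theory Num.Theory.
Import numFieldNormedType.Exports.
Local Open Scope classical_set_scope.
Local Open Scope ring_scope.

(** * Quadratic forms, the spectral norm and coercivity *)

Section QuadraticForms.
Context {K : realType} {n : nat}.
Implicit Types (x y z : 'cV[K]_n) (M N : 'M[K]_n) (a c : K).

Definition dot x y : K := (x^T *m y) ord0 ord0.

Lemma dotE x y : dot x y = \sum_i x i ord0 * y i ord0.
Proof. by rewrite /dot mxE; apply: eq_bigr => i _; rewrite mxE. Qed.

Lemma dotC x y : dot x y = dot y x.
Proof. by rewrite !dotE; apply: eq_bigr => i _; rewrite mulrC. Qed.

Lemma dotDl x y z : dot (x + y) z = dot x z + dot y z.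
Proof. by rewrite /dot linearD mulmxDl mxE. Qed.

Lemma dotDr x y z : dot z (x + y) = dot z x + dot z y.
Proof. by rewrite /dot mulmxDr mxE. Qed.

Lemma dotNl x z : dot (- x) z = - dot x z.
Proof. by rewrite /dot linearN mulNmx mxE. Qed.

Lemma dotNr x z : dot z (- x) = - dot z x.
Proof. by rewrite /dot mulmxN mxE. Qed.

Lemma dotZl a x z : dot (a *: x) z = a * dot x z.
Proof. by rewrite /dot linearZ -scalemxAl mxE. Qed.

Lemma dotZr a x z : dot z (a *: x) = a * dot z x.
Proof. by rewrite /dot -scalemxAr mxE. Qed.

Lemma dot0r x : dot x 0 = 0.
Proof. by rewrite /dot mulmx0 mxE. Qed.

Definition dot_lin := (dotDl, dotDr, dotNl, dotNr, dotZl, dotZr).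

Lemma dot_adj M x y : dot x (M *m y) = dot (M^T *m x) y.
Proof. by rewrite /dot trmx_mul trmxK mulmxA. Qed.

Lemma dot_sym M x y : M^T = M -> dot x (M *m y) = dot (M *m x) y.
Proof. by move=> Ms; rewrite dot_adj Ms. Qed.

Lemma dot_ge0 x : 0 <= dot x x.
Proof. by rewrite dotE; apply: sumr_ge0 => i _; rewrite -expr2 sqr_ge0. Qed.

Lemma dot_eq0 x : dot x x = 0 -> x = 0.
Proof.
rewrite dotE => /eqP; rewrite psumr_eq0 => [/allP h|i _]; last by rewrite -expr2 sqr_ge0.
apply/colP => i; rewrite mxE; apply/eqP.
by have := h i (mem_index_enum _); rewrite mulf_eq0 orbb.
Qed.

Lemma dot_gt0 x : x != 0 -> 0 < dot x x.
Proof.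
by move=> x0; rewrite lt_def dot_ge0 andbT; apply: contra_neq x0; apply: dot_eq0.
Qed.

Lemma qformE M x : qform M x = dot x (M *m x).
Proof. by rewrite /qform /dot mulmxA. Qed.

Lemma qformD M N x : qform (M + N) x = qform M x + qform N x.
Proof. by rewrite !qformE mulmxDl dotDr. Qed.

Lemma qformN M x : qform (- M) x = - qform M x.
Proof. by rewrite !qformE mulNmx dotNr. Qed.

Lemma qformB M N x : qform (M - N) x = qform M x - qform N x.
Proof. by rewrite qformD qformN. Qed.

Lemma qformZ a M x : qform (a *: M) x = a * qform M x.
Proof. by rewrite !qformE -scalemxAl dotZr. Qed.

Lemma qform0 x : qform (0 : 'M[K]_n) x = 0.
Proof. by rewrite qformE mul0mx dot0r. Qed.

Lemma qform_sum M x : qform M x = \sum_i \sum_j x i ord0 * M i j * x j ord0.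
Proof.
rewrite qformE dotE; apply: eq_bigr => i _; rewrite mxE big_distrr /=.
by apply: eq_bigr => j _; rewrite mulrA.
Qed.

Lemma psd_Cauchy_Schwarz M x y : psd_cone M ->
  dot x (M *m y) ^+ 2 <= qform M x * qform M y.
Proof.
move=> [Ms M0]; set b := dot x (M *m y).
have bE : dot y (M *m x) = b by rewrite dot_sym// dotC.
have h a c : 0 <= a ^+ 2 * qform M x + 2 * a * c * b + c ^+ 2 * qform M y.
  have := M0 (a *: x + c *: y).
  rewrite qformE mulmxDr -!scalemxAr !dot_lin bE -/b -!qformE => /le_trans; apply.
  by rewrite le_eqVlt; apply/orP; left; apply/eqP; ring.
have [x0|x0] := eqVneq (qform M x) 0.
  have [->|b0] := eqVneq b 0; first by rewrite expr0n /= mulr_ge0.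
  (* When [qform M x = 0] the form at [a x + y] is affine in [a] with slope [2 b]; this [a] makes it
     equal to [-1]. *)
  have := h (- (qform M y + 1) / (2 * b)) 1.
  suff -> : (- (qform M y + 1) / (2 * b)) ^+ 2 * qform M x
     + 2 * (- (qform M y + 1) / (2 * b)) * 1 * b + 1 ^+ 2 * qform M y = -1 by lra.
  by rewrite x0; field.
have xp : 0 < qform M x by rewrite lt_def x0 M0.
(* The ratio [- b / qform M x] minimizes the form along [y + s x]; scaling by [qform M x] clears the
   denominator. *)
have := h (- b) (qform M x).
have -> : (- b) ^+ 2 * qform M x + 2 * - b * qform M x * b
   + qform M x ^+ 2 * qform M y = qform M x * (qform M x * qform M y - b ^+ 2) by ring.
by rewrite pmulr_rge0// subr_ge0.
Qed.

Lemma psd_cone1 : psd_cone (1%:M : 'M[K]_n).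
Proof. by split=> [|x]; rewrite ?trmx1// qformE mul1mx dot_ge0. Qed.

Lemma Cauchy_Schwarz x y : dot x y ^+ 2 <= dot x x * dot y y.
Proof. by have := psd_Cauchy_Schwarz x y psd_cone1; rewrite !qformE !mul1mx. Qed.

(** Cauchy-Schwarz at the pair [M x], [x] bounds [|M x|^4] by a multiple of [qform M x]. *)
Lemma psd_ker M x : psd_cone M -> qform M x = 0 -> M *m x = 0.
Proof.
move=> Mp x0; apply: dot_eq0; apply/eqP; rewrite -sqrf_eq0 eq_le sqr_ge0 andbT.
by have := psd_Cauchy_Schwarz (M *m x) x Mp; rewrite x0 mulr0.
Qed.

(** A crude substitute for the operator norm: it dominates forms too, and continuity and boundedness
    in time pass to it from the entries. *)
Definition entry_sum M : K := \sum_i \sum_j `|M i j|.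

Lemma entry_sum_ge0 M : 0 <= entry_sum M.
Proof. by apply: sumr_ge0 => i _; apply: sumr_ge0. Qed.

Lemma l2normE x : l2norm x = Num.sqrt (dot x x).
Proof. by rewrite /l2norm dotE; congr Num.sqrt; apply: eq_bigr => i _; rewrite expr2. Qed.

Lemma l2norm_ge0 x : 0 <= l2norm x.
Proof. by rewrite l2normE sqrtr_ge0. Qed.

Lemma sqr_l2norm x : l2norm x ^+ 2 = dot x x.
Proof. by rewrite l2normE sqr_sqrtr// dot_ge0. Qed.

Lemma l2norm_eq0 x : l2norm x = 0 -> x = 0.
Proof. by move=> x0; apply: dot_eq0; rewrite -sqr_l2norm x0 expr0n. Qed.

Lemma l2normZ a x : 0 <= a -> l2norm (a *: x) = a * l2norm x.
Proof.
move=> a0; rewrite !l2normE dotZl dotZr mulrA -expr2 sqrtrM ?sqr_ge0//.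
by rewrite sqrtr_sqr ger0_norm.
Qed.

Lemma l2norm_le c x y : 0 <= c -> dot x x <= c ^+ 2 * dot y y ->
  l2norm x <= c * l2norm y.
Proof.
move=> c0 h; rewrite -(@ler_pXn2r _ 2)// ?nnegrE ?mulr_ge0 ?l2norm_ge0//.
by rewrite exprMn !sqr_l2norm.
Qed.

Lemma dot_le x y : `|dot x y| <= l2norm x * l2norm y.
Proof.
rewrite -(@ler_pXn2r _ 2)// ?nnegrE ?mulr_ge0 ?l2norm_ge0//.
by rewrite exprMn !sqr_l2norm real_normK ?num_real// Cauchy_Schwarz.
Qed.

Lemma bilin_le_entry_sum M x y :
  `|dot x (M *m y)| <= entry_sum M * (l2norm x * l2norm y).
Proof.
have entry z i : `|z i ord0| <= l2norm z.
  rewrite -sqrtr_sqr l2normE ler_wsqrtr// dotE (bigD1 i)//= -expr2 lerDl.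
  by apply: sumr_ge0 => j _; rewrite -expr2 sqr_ge0.
rewrite dotE (le_trans (ler_norm_sum _ _ _))// mulr_suml ler_sum// => i _.
rewrite mxE normrM mulrC.
rewrite (le_trans (ler_wpM2r _ (ler_norm_sum _ _ _)))// !mulr_suml ler_sum// => j _.
rewrite normrM -mulrA ler_wpM2l// mulrC ler_pM//; exact: entry.
Qed.

Lemma qform_le_entry_sum M x : `|qform M x| <= entry_sum M * dot x x.
Proof. by rewrite qformE -sqr_l2norm expr2 bilin_le_entry_sum. Qed.

Lemma spectral_norm_has_sup M :
  has_sup [set l2norm (M *m x) | x in [set x | l2norm x <= 1]].
Proof.
split; first by exists (l2norm (M *m 0)), 0 => //=; rewrite l2normE dot0r sqrtr0.
exists (Num.sqrt (entry_sum (M^T *m M))) => _ [x /= x1 <-].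
rewrite l2normE ler_wsqrtr//.
have -> : dot (M *m x) (M *m x) = qform (M^T *m M) x.
  by rewrite qformE -mulmxA [RHS]dot_adj trmxK.
apply: le_trans (ler_norm _) _; apply: le_trans (qform_le_entry_sum _ _) _.
by rewrite ler_piMr ?entry_sum_ge0// -sqr_l2norm expr_le1// l2norm_ge0.
Qed.

Lemma spectral_norm_ge0 M : 0 <= spectral_norm M.
Proof.
apply: le_trans (l2norm_ge0 (M *m 0)) _.
apply: sup_upper_bound; first exact: spectral_norm_has_sup.
by exists 0 => //=; rewrite l2normE dot0r sqrtr0.
Qed.

Lemma l2norm_mulmx_le M x : l2norm (M *m x) <= spectral_norm M * l2norm x.
Proof.
have [/l2norm_eq0 ->|x0] := eqVneq (l2norm x) 0.
  by rewrite mulmx0 l2normE dot0r sqrtr0 mulr0.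
have xp : 0 < l2norm x by rewrite lt_def x0 l2norm_ge0.
rewrite -ler_pdivrMr// mulrC -l2normZ ?invr_ge0 ?l2norm_ge0// scalemxAr.
apply: sup_upper_bound; first exact: spectral_norm_has_sup.
by exists ((l2norm x)^-1 *: x) => //=; rewrite l2normZ ?invr_ge0 ?l2norm_ge0// mulVf.
Qed.

Lemma spectral_norm_le M c : 0 <= c ->
  (forall x, l2norm (M *m x) <= c * l2norm x) -> spectral_norm M <= c.
Proof.
move=> c0 h; apply: ge_sup.
  by have [] := spectral_norm_has_sup M.
by move=> _ [x /= x1 <-]; rewrite (le_trans (h x))// ler_piMr.
Qed.

Lemma bilin_le_spectral M x y :
  `|dot x (M *m y)| <= spectral_norm M * (l2norm x * l2norm y).
Proof.
apply: le_trans (dot_le _ _) _; rewrite mulrCA ler_wpM2l ?l2norm_ge0//.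
exact: l2norm_mulmx_le.
Qed.

Lemma qform_le_spectral M x : `|qform M x| <= spectral_norm M * dot x x.
Proof. by rewrite qformE -sqr_l2norm expr2 bilin_le_spectral. Qed.

Lemma spectral_normN M : spectral_norm (- M) = spectral_norm M.
Proof.
suff h N : spectral_norm (- N) <= spectral_norm N.
  by apply/eqP; rewrite eq_le h -{1}(opprK M) h.
apply: spectral_norm_le (spectral_norm_ge0 _) _ => x.
have -> : l2norm (- N *m x) = l2norm (N *m x).
  by rewrite !l2normE mulNmx dotNl dotNr opprK.
exact: l2norm_mulmx_le.
Qed.

(** Loewner inequalities control only quadratic forms; symmetry converts a two-sided bound on the
    form into a bound on the norm. *)
Lemma l2norm_sym_le M c x : M^T = M -> 0 <= c ->
  (forall y, `|qform M y| <= c * dot y y) -> l2norm (M *m x) <= c * l2norm x.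
Proof.
move=> Ms c0 h; apply: l2norm_le => //; set u := M *m x.
(* The polarization below ends with a division by [c]. For [c = 0] the form vanishes identically and
   [psd_ker] gives [M x = 0]. *)
have [cn0|cn0] := eqVneq c 0.
  rewrite cn0 in h; have M0 y : qform M y = 0 by apply/eqP; rewrite -normr_le0 (le_trans (h y))// mul0r.
  have : psd_cone M by split=> // y; rewrite M0.
  by move=> /psd_ker /(_ (M0 x)); rewrite -/u => ->; rewrite cn0 dot0r expr0n mul0r.
(* Polarization at [c x + M x] and [c x - M x]. *)
have := h (c *: x + u); have := h (c *: x - u).
rewrite !ler_norml => /andP[h1 _] /andP[_ h2].
have E1 : qform M (c *: x + u) = c ^+ 2 * dot x u + 2 * c * dot u u + dot u (M *m u).
  rewrite qformE mulmxDr -scalemxAr !dot_lin -/u (dot_sym x u Ms) -/u; ring.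
have E2 : qform M (c *: x - u) = c ^+ 2 * dot x u - 2 * c * dot u u + dot u (M *m u).
  rewrite qformE mulmxBr -scalemxAr !dot_lin -/u (dot_sym x u Ms) -/u; ring.
have F1 : dot (c *: x + u) (c *: x + u) = c ^+ 2 * dot x x + 2 * c * dot x u + dot u u.
  by rewrite !dot_lin (dotC u x); ring.
have F2 : dot (c *: x - u) (c *: x - u) = c ^+ 2 * dot x x - 2 * c * dot x u + dot u u.
  by rewrite !dot_lin (dotC u x); ring.
(* Subtracting the two bounds cancels [dot u (M *m u)] and leaves
   [4 c |u|^2 <= 2 c (c^2 |x|^2 + |u|^2)]. *)
rewrite E2 F2 in h1; rewrite E1 F1 in h2.
have cp : 0 < c by rewrite lt_def cn0.
rewrite -(ler_pM2l cp); nra.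
Qed.

Lemma spectral_norm_sym_le M c : M^T = M -> 0 <= c ->
  (forall y, `|qform M y| <= c * dot y y) -> spectral_norm M <= c.
Proof. by move=> Ms c0 h; apply: spectral_norm_le => // x; apply: l2norm_sym_le. Qed.

Lemma posdef_psd M : posdef M -> psd_cone M.
Proof.
move=> [Ms Mp]; split=> // x; have [->|x0] := eqVneq x 0; last exact/ltW/Mp.
by rewrite qformE mulmx0 dot0r.
Qed.

(* Cauchy-Schwarz for the form of [M], applied to [x] and [M^-1 x]. *)
Lemma posdef_coercive M : posdef M ->
  exists2 c, 0 < c & forall x, c * dot x x <= qform M x.
Proof.
move=> Mpd; have Mpsd := posdef_psd Mpd; have [Ms Mp] := Mpd.
have Mu : M \in unitmx.
  rewrite -unitmx_tr -row_free_unit -kermx_eq0; apply/rowV0P => v /sub_kermxP vM.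
  apply/eqP/contraT => v0; have /Mp : v^T != 0 by rewrite trmx_eq0.
  rewrite qformE; suff -> : M *m v^T = 0 by rewrite dot0r ltxx.
  by rewrite -(trmxK M) -trmx_mul vM trmx0.
set b := spectral_norm (invmx M) + 1.
have bp : 0 < b by rewrite ltr_wpDl ?spectral_norm_ge0.
exists b^-1 => [|x]; first by rewrite invr_gt0.
set w := invmx M *m x; have Mw : M *m w = x by rewrite mulmxA mulmxV// mul1mx.
have wx : dot w x <= b * dot x x.
  rewrite dotC -qformE (le_trans (ler_norm _))// (le_trans (qform_le_spectral _ _))//.
  by rewrite ler_wpM2r ?dot_ge0// lerDl.
have := psd_Cauchy_Schwarz x w Mpsd; rewrite Mw (qformE _ w) Mw => xx.
have [/dot_eq0 ->|x0] := eqVneq (dot x x) 0.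
  by rewrite dot0r mulr0 qformE mulmx0 dot0r.
have xp : 0 < dot x x by rewrite lt_def x0 dot_ge0.
rewrite ler_pdivrMl// -(ler_pM2l xp) -expr2 (le_trans xx)//.
have -> : dot x x * (b * qform M x) = qform M x * (b * dot x x) by ring.
by rewrite ler_wpM2l//; case: Mpsd.
Qed.

End QuadraticForms.

(** * Comparison principle for matrix differential inequalities *)

Lemma is_derive_expRM (K : realType) (k t : K) :
  is_derive t 1 (fun s => expR (k * s)) (k * expR (k * t)).
Proof.
have h : is_derive t 1 (fun s : K => k * s) k.
  have -> : (fun s : K => k * s) = k *: id by apply/funext.
  by apply: is_derive_eq; rewrite -[LHS]/(_ * _) mulr1.
by rewrite mulrC; apply: is_derive1_comp.
Qed.

Section Comparison.
Context {K : realType} {n : nat}.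
Implicit Types (V : K -> 'M[K]_n) (x : 'cV[K]_n) (t s e T : K).

(** Stated per entry so that sums, products and quadratic forms reduce to the scalar rules;
    [ode_entrywise] makes the passage from matrix-valued solutions. *)
Definition entrywise_continuous V :=
  forall i j, {within [set t : K | 0 <= t], continuous (fun t => V t i j)}.

Definition entrywise_derive t V (D : 'M[K]_n) :=
  forall i j, is_derive t 1 (fun s => V s i j) (D i j).

Lemma within_dist (f : K -> K) t e :
  {within [set t : K | 0 <= t], continuous f} -> 0 <= t -> 0 < e ->
  exists2 d, 0 < d & forall s, 0 <= s -> `|s - t| < d -> `|f s - f t| < e.
Proof.
move=> /subspace_continuousP /(_ t) fc t0 e0.
have /cvgrPdist_lt /(_ _ e0) := fc t0.
move=> [d /= d0 H]; exists d => // s s0 sd.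
by rewrite distrC; apply: H => //=; rewrite distrC.
Qed.

(** Combined with [qform_le_entry_sum], this makes the form of [V s] continuous in [s] with one
    radius for all vectors [x], relative to [|x|^2]. *)
Lemma entry_sum_dist V t e : entrywise_continuous V -> 0 <= t -> 0 < e ->
  exists2 d, 0 < d &
    forall s, 0 <= s -> `|s - t| < d -> entry_sum (V s - V t) < e.
Proof.
move=> Vc t0 e0.
set F := within [set t : K | 0 <= t] (nbhs t).
have fc : (fun s => entry_sum (V s - V t)) @ F
    --> \sum_(i < n) \sum_(j < n) (0 : K).
  apply: cvg_big => [|i _]; first exact: add_continuous.
  apply: cvg_big => [|j _]; first exact: add_continuous.
  have /subspace_continuousP /(_ t t0) h : {within [set t : K | 0 <= t], continuous (fun t => V t i j)} := Vc i j.
  rewrite -/F in h.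
  rewrite [X in _ --> X](_ : 0 = `|V t i j - V t i j|); last by rewrite subrr normr0.
  under eq_fun do rewrite !mxE.
  by apply: cvg_norm; apply: cvgB; [exact: h | exact: cvg_cst].
rewrite big1 in fc; last by move=> i _; rewrite big1.
have /cvgrPdist_lt /(_ _ e0) [d /= d0 H] := fc.
exists d => // s s0 sd.
have := H s; rewrite /= distrC => /(_ sd s0).
by rewrite sub0r normrN ger0_norm ?entry_sum_ge0.
Qed.

Lemma entry_sum_bounded V T : entrywise_continuous V -> 0 <= T ->
  exists2 B, 0 <= B & forall t, 0 <= t <= T -> entry_sum (V t) <= B.
Proof.
move=> Vc T0.
have h i j : exists B, forall t, 0 <= t <= T -> `|V t i j| <= B.
  have c : {within `[0, T], continuous (fun t => `|V t i j|)}.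
    apply: (@continuous_subspaceW _ _ _ [set t : K | 0 <= t]).
      by move=> t /=; rewrite in_itv /= => /andP[].
    apply/subspace_continuousP => t t0; apply: cvg_norm.
    by have /subspace_continuousP := Vc i j; apply.
  have [s _ H] := EVT_max T0 c.
  by exists `|V s i j| => t tT; apply: H; rewrite in_itv.
have [B HB] : exists B : 'M[K]_n, forall i j t, 0 <= t <= T -> `|V t i j| <= B i j.
  have /choice[f Hf] : forall p : 'I_n * 'I_n, exists B,
      forall t, 0 <= t <= T -> `|V t p.1 p.2| <= B by move=> p; apply: h.
  by exists (\matrix_(i, j) f (i, j)) => i j t tT; rewrite mxE (Hf (i, j)).
exists (entry_sum B); first exact: entry_sum_ge0.
move=> t tT; apply: ler_sum => i _; apply: ler_sum => j _.
exact: le_trans (HB i j t tT) (ler_norm _).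
Qed.

Lemma entrywise_derive_qform t V D x : entrywise_derive t V D ->
  is_derive t 1 (fun s => qform (V s) x) (qform D x).
Proof.
move=> VD; rewrite qform_sum.
have -> : (fun s => qform (V s) x)
    = \sum_i \sum_j (fun s => x i ord0 * V s i j * x j ord0).
  by apply/funext => s; rewrite qform_sum fct_sumE; apply: eq_bigr => i _; rewrite fct_sumE.
apply: is_derive_sum => i; apply: is_derive_sum => j.
have h := VD i j.
have -> : (fun s => x i ord0 * V s i j * x j ord0)
   = (x i ord0 * x j ord0) *: (fun s => V s i j).
  by apply/funext => s /=; rewrite -[RHS]/(_ * _ * _); ring.
apply: is_derive_eq.
by rewrite -[LHS]/(_ * _); ring.
Qed.

Lemma left_min_derive_le0 (q : K -> K) a t d : is_derive t 1 q d -> a < t ->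
  (forall s, a <= s < t -> q t <= q s) -> d <= 0.
Proof.
move=> [/= dv <-] at_ h; rewrite leNgt; apply/negP => dp.
have /cvgrPdist_lt /(_ _ dp) [e /= e0 H] := dv.
set u := Num.min (e / 2) (t - a).
have up : 0 < u by rewrite lt_min subr_gt0 at_ divr_gt0.
have ue : u < e by rewrite gt_min; apply/orP; left; lra.
have ut : u <= t - a by rewrite ge_min lexx orbT.
have := H (- u); rewrite /= sub0r opprK gtr0_norm// => /(_ ue).
rewrite oppr_eq0 gt_eqF// => /(_ isT).
have /h : a <= - u + t < t by apply/andP; split; lra.
rewrite -subr_ge0 => h1.
have v0 : (- u)^-1 *: (q (- u + t) - q t) <= 0.
  by rewrite invrN -[_ *: _]/(_ * _) mulNr oppr_le0 mulr_ge0// invr_ge0 ltW.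
rewrite [_ *: 1]mulr1 ltr_norml => /andP[_].
by rewrite ltrBlDr ltrDl ltNge v0.
Qed.

(** Removes the regularization of size [e] at the end of the first-exit argument. *)
Lemma ler_add_small (a b c : K) : 0 <= b -> 0 < c ->
  (forall e, 0 < e -> 0 <= a + e * b * c) -> 0 <= a.
Proof.
move=> b0 c0 h; rewrite leNgt; apply/negP => a0.
have bc : 0 < b * c + 1 by have := mulr_ge0 b0 (ltW c0); lra.
have := h (- a / (2 * (b * c + 1))).
have -> : a + - a / (2 * (b * c + 1)) * b * c = a * (b * c + 2) / (2 * (b * c + 1)).
  by field; rewrite gt_eqF.
rewrite divr_gt0 ?oppr_gt0 ?mulr_gt0// => /(_ isT).
rewrite pmulr_lge0 ?invr_gt0 ?mulr_gt0// leNgt => /negP; apply.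
by rewrite nmulr_rlt0//; lra.
Qed.

(* First-exit argument: while [V + eta e^{kappa t}] is positive definite it
   cannot acquire a kernel vector [x], since there the derivative of its form
   at [x] would be positive. *)
Lemma psd_comparison V (dV G : K -> 'M[K]_n) (T L : K) :
  0 <= T -> psd_cone (V 0) -> entrywise_continuous V ->
  (forall t, 0 <= t <= T -> (V t)^T = V t) ->
  (forall t, 0 < t <= T -> entrywise_derive t V (dV t)) ->
  (forall t x, 0 < t <= T -> qform (G t) x <= L * dot x x) ->
  (forall t x, 0 < t <= T ->
    2 * dot ((G t)^T *m x) (V t *m x) <= qform (dV t) x) ->
  psd_cone (V T).
Proof.
move=> T0 [_ V0] Vc Vs VD GL VN; split=> [|x]; first by rewrite Vs// T0 lexx.
(* At a kernel vector the inequality on [dV] costs at most [2 L e expR (k t) |x|^2], while the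
   regularization gains [k e expR (k t) |x|^2]; any rate above [2 L] leaves a positive
   derivative. *)
pose k := 2 * L + 1.
apply: (@ler_add_small _ (expR (k * T)) (dot x x + 1)); rewrite ?expR_ge0//.
  by rewrite ltr_wpDl ?dot_ge0.
move=> e e0.
pose w t x := qform (V t) x + e * expR (k * t) * dot x x.
suff : 0 <= w T x.
  move=> /le_trans; apply; apply: lerD => //.
  by apply: ler_wpM2l; [rewrite mulr_ge0 ?expR_ge0// ltW|rewrite lerDl].
move: x.
have Ek t : 0 < e * expR (k * t) by rewrite mulr_gt0 ?expR_gt0.
have w0 x : 0 <= w 0 x by rewrite addr_ge0// mulr_ge0 ?dot_ge0// ltW.
(* The supremum [ts] of these times is the candidate exit time; the aim is [ts = T]. *)
pose Good := [set t | 0 <= t <= T /\ forall s, 0 <= s <= t -> forall x, 0 <= w s x].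
have G0 : Good 0.
  by split=> [|s]; rewrite ?lexx ?T0// -eq_le => /eqP <-.
have Gs : has_sup Good by split; [exists 0 | exists T => t [/andP[]]].
set ts := sup Good.
have ts0 : 0 <= ts by apply: sup_upper_bound.
have tsT : ts <= T by apply: ge_sup; [exists 0 | move=> t [/andP[]]].
have wlt s x : 0 <= s < ts -> 0 <= w s x.
  move=> /andP[s0 sts].
  have /sup_adherent /(_ Gs) [t [_ Gt] st] : 0 < ts - s by rewrite subr_gt0.
  by apply: Gt; rewrite s0 ltW//; rewrite opprB addrC subrK in st.
have w_dist d : 0 < d -> exists2 r, 0 < r & forall s, 0 <= s -> `|s - ts| < r ->
    forall x, `|w s x - w ts x| <= d * dot x x.
  move=> d0; have d2 : 0 < d / 2 by rewrite divr_gt0.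
  have [r1 r10 H1] := entry_sum_dist Vc ts0 d2.
  have ec : {within [set t : K | 0 <= t], continuous (fun t => e * expR (k * t))}.
    apply: continuous_subspaceT => t.
    by apply: cvgM; [exact: cvg_cst|apply: continuous_cvg; [exact: continuous_expR|
      apply: cvgM; [exact: cvg_cst|exact: cvg_id]]].
  have [r2 r20 H2] := within_dist ec ts0 d2.
  exists (Num.min r1 r2); first by rewrite lt_min r10.
  move=> s s0; rewrite lt_min => /andP[/(H1 _ s0) h1 /(H2 _ s0) h2] x.
  have -> : w s x - w ts x = qform (V s - V ts) x
      + (e * expR (k * s) - e * expR (k * ts)) * dot x x by rewrite qformB /w; ring.
  rewrite (le_trans (ler_normD _ _))// (splitr d) [leRHS]mulrDl lerD//.
    rewrite (le_trans (qform_le_entry_sum _ _))// ler_wpM2r ?dot_ge0// ltW//.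
  by rewrite normrM (ger0_norm (dot_ge0 _)) ler_wpM2r ?dot_ge0// ltW.
(* Nonnegativity passes to the supremum: a negative value at [ts] would persist shortly before
   [ts]. *)
have wts x : 0 <= w ts x.
  have [->//|tsn0] := eqVneq ts 0.
  have tsp : 0 < ts by rewrite lt_def tsn0.
  rewrite leNgt; apply/negP => wn.
  have xp : 0 < dot x x + 1 by rewrite ltr_wpDl ?dot_ge0.
  have [r r0 H] : exists2 r, 0 < r & forall s, 0 <= s -> `|s - ts| < r ->
      forall y, `|w s y - w ts y| <= - w ts x / (2 * (dot x x + 1)) * dot y y.
    by apply: w_dist; rewrite divr_gt0 ?oppr_gt0 ?mulr_gt0.
  pose s := Num.max 0 (ts - r / 2).
  have s0 : 0 <= s by rewrite le_max lexx.
  have sts : s < ts by rewrite gt_max tsp/=; lra.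
  have sr : `|s - ts| < r.
    rewrite distrC gtr0_norm ?subr_gt0//.
    have : ts - r / 2 <= s by rewrite le_max lexx orbT.
    by lra.
  have := H s s0 sr x; rewrite ler_norml => /andP[_].
  have := wlt s x; rewrite s0 sts => /(_ isT) ws h.
  have : - w ts x <= - w ts x / (2 * (dot x x + 1)) * dot x x by lra.
  rewrite mulrAC -mulrA -[leLHS]mulr1 ler_pM2l ?oppr_gt0//.
  by rewrite ler_pdivlMr ?mulr_gt0//; have := dot_ge0 x; lra.
(* Nonnegativity at [ts] is upgraded to coercivity, which leaves room to go past [ts]. *)
have [c c0 Hc] : exists2 c, 0 < c & forall x, c * dot x x <= w ts x.
  pose W := V ts + (e * expR (k * ts))%:M.
  have WE x : qform W x = w ts x.
    by rewrite qformD [X in _ + X]qformE mul_scalar_mx dotZr.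
  have Ws : W^T = W by rewrite linearD /= tr_scalar_mx Vs// ts0.
  have Wp : psd_cone W by split=> // x; rewrite WE.
  have : posdef W.
    split=> // x x0; rewrite lt_def WE wts andbT; apply/negP => /eqP wx.
    have xp := dot_gt0 x0.
    have tsp : 0 < ts.
      rewrite lt_def ts0 andbT; apply/eqP => tsE; move: wx; rewrite tsE => wx.
      have := V0 x; have := mulr_gt0 (Ek 0) xp; rewrite /w in wx; lra.
    have tsI : 0 < ts <= T by rewrite tsp.
    have : W *m x = 0 by apply: psd_ker => //; rewrite WE.
    rewrite mulmxDl mul_scalar_mx => /eqP; rewrite addr_eq0 => /eqP Vx.
    have := VN _ x tsI; rewrite Vx dotNr dotZr => VN'.
    have := GL _ x tsI; rewrite qformE dot_adj => GL'.
    have Dw : is_derive ts 1 (fun s => w s x)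
        (qform (dV ts) x + e * (k * expR (k * ts)) * dot x x).
      have h1 := entrywise_derive_qform x (VD _ tsI).
      apply: is_deriveD.
      have -> : (fun s => e * expR (k * s) * dot x x)
          = (e * dot x x) *: (fun s => expR (k * s)) :> (K -> K).
        by apply/funext => s; rewrite -[RHS]/(_ * _ * _); ring.
      have h2 := is_derive_expRM k ts.
      by apply: is_derive_eq; rewrite -[LHS]/(_ * _); ring.
    (* The kernel vector gives [w ts x = 0], a minimum over earlier times, so the derivative would
       be nonpositive. *)
    have := left_min_derive_le0 Dw tsp.
    suff h : 0 < qform (dV ts) x + e * (k * expR (k * ts)) * dot x x.
      move=> /(_ _)/wrap[s|]; first by rewrite wx => /(wlt _ x).
      by rewrite leNgt h.
    have h3 := mulr_gt0 (Ek ts) xp.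
    have h4 : e * expR (k * ts) * dot ((G ts)^T *m x) x
        <= e * expR (k * ts) * (L * dot x x) by rewrite ler_wpM2l// ltW.
    rewrite /k in h3 h4 VN' *; lra.
  by move=> /posdef_coercive [c c0 Hc]; exists c => // x; rewrite -WE.
suff -> : T = ts by [].
apply/eqP; rewrite eq_le tsT andbT leNgt; apply/negP => tsltT.
(* For times within [r] of [ts] the form moves by at most [c |x|^2], no more than its value at
   [ts]. *)
have [r r0 H] := w_dist c c0.
pose t' := Num.min T (ts + r / 2).
have tst' : ts < t' by rewrite lt_min tsltT/=; lra.
have : Good t'.
  split; first by rewrite (le_trans ts0 (ltW tst')) ge_min lexx.
  move=> s /andP[s0 st'] x.
  have [sts|tss] := ltP s ts; first by apply: wlt; rewrite s0.
  have : `|s - ts| < r.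
    rewrite ger0_norm ?subr_ge0//.
    have : t' <= ts + r / 2 by rewrite ge_min lexx orbT.
    by lra.
  move=> /(H s s0) /(_ x); rewrite ler_norml => /andP[h _].
  by have := Hc x; lra.
by move=> /(sup_upper_bound Gs); rewrite -/ts leNgt tst'.
Qed.

End Comparison.

(** * Entrywise calculus for matrix paths *)

Section EntrywiseCalculus.
Context {K : realType} {n : nat}.
Implicit Types (V W : K -> 'M[K]_n) (D E M : 'M[K]_n) (t s : K).

Lemma entrywise_derive_cst t M : entrywise_derive t (fun=> M) 0.
Proof. by move=> i j; rewrite mxE; apply: is_derive_cst. Qed.

Lemma entrywise_deriveD t V W D E : entrywise_derive t V D ->
  entrywise_derive t W E -> entrywise_derive t (fun s => V s + W s) (D + E).
Proof.
move=> VD WE i j; rewrite mxE; under eq_fun do rewrite mxE.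
by have := VD i j; have := WE i j; move=> *; apply: is_deriveD.
Qed.

Lemma entrywise_deriveN t V D : entrywise_derive t V D ->
  entrywise_derive t (fun s => - V s) (- D).
Proof.
move=> VD i j; rewrite mxE; under eq_fun do rewrite mxE.
by have := VD i j; move=> *; apply: is_deriveN.
Qed.

Lemma entrywise_derive_tr t V D : entrywise_derive t V D ->
  entrywise_derive t (fun s => (V s)^T) D^T.
Proof. by move=> VD i j; rewrite mxE; under eq_fun do rewrite mxE; apply: VD. Qed.

Lemma entrywise_deriveZ t (m : K -> K) V dm D : is_derive t 1 m dm ->
  entrywise_derive t V D ->
  entrywise_derive t (fun s => m s *: V s) (dm *: V t + m t *: D).
Proof.
move=> mD VD i j; rewrite !mxE; under eq_fun do rewrite mxE.
have h := VD i j; have h2 := is_deriveM mD h; apply: is_derive_eq.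
by rewrite -[LHS]/(_ * _ + _ * _); ring.
Qed.

Lemma entrywise_derive_mul t V W D E : entrywise_derive t V D ->
  entrywise_derive t W E ->
  entrywise_derive t (fun s => V s *m W s) (D *m W t + V t *m E).
Proof.
move=> VD WE i j; rewrite !mxE -big_split /=.
have -> : (fun s => (V s *m W s) i j)
    = \sum_k (fun s => V s i k * W s k j) by rewrite fct_sumE; apply/funext => s; rewrite mxE.
apply: is_derive_sum => k.
have h1 := VD i k; have h2 := WE k j; have h := is_deriveM h1 h2; apply: is_derive_eq.
by rewrite -[LHS]/(_ * _ + _ * _); ring.
Qed.

Lemma entrywise_continuous_cst M : entrywise_continuous (fun=> M).
Proof. by move=> i j; apply: continuous_subspaceT => t; exact: cvg_cst. Qed.

Lemma entrywise_continuousD V W : entrywise_continuous V ->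
  entrywise_continuous W -> entrywise_continuous (fun s => V s + W s).
Proof.
move=> Vc Wc i j; have -> : (fun s => (V s + W s) i j) = (fun s => V s i j + W s i j)
  by apply/funext => s; rewrite mxE.
by apply: within_continuousD; [exact: Vc|exact: Wc].
Qed.

Lemma entrywise_continuousN V : entrywise_continuous V ->
  entrywise_continuous (fun s => - V s).
Proof.
move=> Vc i j; have -> : (fun s => (- V s) i j) = (fun s => - V s i j)
  by apply/funext => s; rewrite mxE.
have -> : (fun s => - V s i j) = (fun s => 0 - V s i j) by apply/funext => s; rewrite sub0r.
apply: within_continuousB; last exact: Vc.
by apply: continuous_subspaceT => t; exact: cvg_cst.
Qed.

Lemma entrywise_continuous_tr V : entrywise_continuous V ->
  entrywise_continuous (fun s => (V s)^T).
Proof.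
move=> Vc i j; have -> : (fun s => (V s)^T i j) = (fun s => V s j i)
  by apply/funext => s; rewrite mxE.
by apply: Vc. Qed.

Lemma within_ge0_continuousM (f g : K -> K) :
  {within [set t : K | 0 <= t], continuous f} ->
  {within [set t : K | 0 <= t], continuous g} ->
  {within [set t : K | 0 <= t], continuous (fun t => f t * g t)}.
Proof.
move=> /subspace_continuousP fc /subspace_continuousP gc.
apply/subspace_continuousP => t t0.
by apply: cvgM; [exact: fc|exact: gc].
Qed.

Lemma entrywise_continuousZ (m : K -> K) V :
  {within [set t : K | 0 <= t], continuous m} -> entrywise_continuous V ->
  entrywise_continuous (fun s => m s *: V s).
Proof.
move=> mc Vc i j; have -> : (fun s => (m s *: V s) i j) = (fun s => m s * V s i j)
  by apply/funext => s; rewrite mxE.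
by apply: within_ge0_continuousM => //; exact: Vc.
Qed.

Lemma entrywise_continuous_mul V W : entrywise_continuous V ->
  entrywise_continuous W -> entrywise_continuous (fun s => V s *m W s).
Proof.
move=> Vc Wc i j; have -> : (fun s => (V s *m W s) i j) = (fun s => \sum_k V s i k * W s k j)
  by apply/funext => s; rewrite mxE.
apply/subspace_continuousP => t t0.
apply: cvg_big => [|k _]; first exact: add_continuous.
have := within_ge0_continuousM (Vc i k) (Wc k j).
by move=> /subspace_continuousP; apply.
Qed.

Lemma ode_entrywise (F : K -> 'M[K]_n -> 'M[K]_n) X0 (X : K -> 'M[K]_n) :
  ode_solution F X0 X -> [/\ X 0 = X0, entrywise_continuous X &
    forall t, 0 < t -> entrywise_derive t X (F t (X t))].
Proof.
move=> [X0E Xc XD]; split=> // [i j|t /XD [Xd XF] i j].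
  apply/subspace_continuousP => t t0.
  have /subspace_continuousP /(_ t t0) h := Xc.
  exact: cvg_comp h (@coord_continuous _ _ _ i j (X t)).
split; first by have /derivable_mxP := Xd; apply.
by rewrite -XF derive_mx// mxE.
Qed.

(** Turns Riccati fixed points into trajectories, so that the distance estimate applies to them. *)
Lemma ode_solution_cst (F : K -> 'M[K]_n -> 'M[K]_n) M :
  (forall t, F t M = 0) -> ode_solution F M (fun=> M).
Proof.
move=> F0; split=> // [|t _]; first by apply: continuous_subspaceT => t; exact: cvg_cst.
by rewrite F0; exact: is_derive_cst.
Qed.

End EntrywiseCalculus.

(** * Symmetry, positivity and parameter sensitivity for Riccati equations *)

Section RiccatiTrajectories.
Context {K : realType} {n : nat}.
Implicit Types (A R S Q M : 'M[K]_n) (X : K -> 'M[K]_n) (x : 'cV[K]_n) (t T : K).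

Lemma mulmx_cV_eq0 M : (forall x, M *m x = 0) -> M = 0.
Proof.
move=> M0; apply/matrixP => i j; rewrite mxE.
by have := M0 (delta_mx j ord0); rewrite -colE => /colP /(_ i); rewrite !mxE.
Qed.

(** Expressed through the vectors [A^T x] and [Q x], the matrix inequalities to be compared become
    scalar ones, linear in a few inner products. *)
Lemma qform_ricc A R S Q x : Q^T = Q ->
  qform (ricc A R S Q) x
  = 2 * dot (A^T *m x) (Q *m x) - dot (Q *m x) (S *m (Q *m x)) + qform R x.
Proof.
move=> Qs; rewrite /ricc !qformD qformN !qformE -!mulmxA.
rewrite (dot_adj A) !(dot_sym x _ Qs) (dotC (Q *m x)); ring.
Qed.

Lemma tr_ricc A R S Q : R^T = R -> S^T = S -> (ricc A R S Q)^T = ricc A R S Q^T.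
Proof.
move=> Rs Ss; rewrite /ricc !linearD /= linearN /= !trmx_mul trmxK Rs Ss !mulmxA.
by rewrite (addrC (_ *m A^T)).
Qed.

(** Taking one gain from [Q] and the other from [M] avoids a quadratic remainder. For [M = Q^T] and
    symmetric [S] the two gains are transposes of each other. *)
Lemma ricc_sub A R S Q M :
  ricc A R S Q - ricc A R S M
  = (A - Q *m S) *m (Q - M) + (Q - M) *m (A^T - S *m M).
Proof.
rewrite /ricc !mulmxBl !mulmxBr !mulmxA.
rewrite opprD addrACA subrr addr0.
apply/matrixP => i j; rewrite !mxE; ring.
Qed.

(** Supplies the constant [L] of [psd_comparison]. It may depend on [T] and on the trajectory, since
    [L] is absent from the conclusion there. *)
Lemma gain_bounded A S X T : entrywise_continuous X -> 0 <= T ->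
  exists2 c, 0 <= c &
    forall t x, 0 <= t <= T -> `|qform (A - X t *m S) x| <= c * dot x x.
Proof.
move=> Xc T0; have [B B0 HB] := entry_sum_bounded Xc T0.
exists (spectral_norm A + B * spectral_norm S).
  by rewrite addr_ge0 ?mulr_ge0 ?spectral_norm_ge0.
move=> t x tT; rewrite qformB (le_trans (ler_normB _ _))// mulrDl lerD//.
  exact: qform_le_spectral.
rewrite qformE -mulmxA (le_trans (bilin_le_entry_sum _ _ _))//.
rewrite -sqr_l2norm -mulrA ler_pM ?entry_sum_ge0 ?mulr_ge0 ?l2norm_ge0 ?HB//.
rewrite expr2 mulrCA ler_wpM2l ?l2norm_ge0//; exact: l2norm_mulmx_le.
Qed.

(* [Z = X - X^T] solves a linear equation; comparing [- Z Z^T] with [0] gives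
   [Z Z^T <= 0]. *)
Lemma riccati_sym A R S Q X T : R^T = R -> S^T = S -> Q^T = Q ->
  ode_solution (fun=> ricc A R S) Q X -> 0 <= T -> (X T)^T = X T.
Proof.
move=> Rs Ss X0s /ode_entrywise[X0E Xc XD] T0.
pose Z t := X t - (X t)^T.
pose dZ t := ricc A R S (X t) - ricc A R S (X t)^T.
have [c c0 Hc] := gain_bounded A S Xc T0.
have dZE t : dZ t = (A - X t *m S) *m Z t + Z t *m (A - X t *m S)^T.
  have -> : (A - X t *m S)^T = A^T - S *m (X t)^T by rewrite linearB /= trmx_mul Ss.
  by rewrite /dZ ricc_sub.
have Zc : entrywise_continuous Z.
  by apply: entrywise_continuousD => //; apply: entrywise_continuousN; apply: entrywise_continuous_tr.
have ZD t : 0 < t -> entrywise_derive t Z (dZ t).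
  move=> t0; rewrite /dZ -tr_ricc//.
  apply: entrywise_deriveD; first exact: XD.
  by apply: entrywise_deriveN; apply: entrywise_derive_tr; exact: XD.
have : psd_cone (- (Z T *m (Z T)^T)).
  (* The derivative of [Z Z^T] also contains the form of [A - X S] at [Z^T x]; shifting the gain by
     [c] absorbs it. *)
  apply: (@psd_comparison _ _ (fun t => - (Z t *m (Z t)^T))
    (fun t => - (dZ t *m (Z t)^T + Z t *m (dZ t)^T))
    (fun t => A - X t *m S + c%:M) T (2 * c)) => //.
  - by rewrite /Z X0E X0s subrr mul0mx oppr0; split=> [|x]; rewrite ?trmx0// qform0.
  - apply: entrywise_continuousN; apply: entrywise_continuous_mul => //.
    exact: entrywise_continuous_tr.
  - by move=> t _; rewrite linearN /= trmx_mul trmxK.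
  - move=> t /andP[t0 _]; apply: entrywise_deriveN; apply: entrywise_derive_mul.
      exact: ZD.
    by apply: entrywise_derive_tr; exact: ZD.
  - move=> t x /andP[t0 tT]; rewrite qformD [X in _ + X]qformE mul_scalar_mx dotZr.
    by have := Hc t x; rewrite (ltW t0) tT => /(_ isT) /ler_normlP[_]; lra.
  - move=> t x /andP[t0 tT]; set u := (Z t)^T *m x.
    set G := A - X t *m S.
    have h1 : dot x (Z t *m u) = dot u u by rewrite dot_adj.
    have h2 : dot x (Z t *m ((dZ t)^T *m x)) = dot x (dZ t *m u).
      by rewrite dot_adj -/u dotC -dot_adj.
    have h3 : dot x (dZ t *m u) = dot x (G *m (Z t *m u)) + qform G u.
      rewrite dZE mulmxDl dotDr -!mulmxA -/G; congr (_ + _).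
      by rewrite dot_adj -/u dot_adj trmxK dotC qformE.
    rewrite -dot_adj mulNmx -mulmxA -/u mulmxN dotNr mulmxDl dotDr mul_scalar_mx dotZr h1.
    rewrite qformN qformD !qformE -!mulmxA -/u h2 h3.
    by have := Hc t u; rewrite (ltW t0) tT => /(_ isT) /ler_normlP[_]; rewrite -/G; lra.
move=> [_ Zn]; apply/esym/eqP; rewrite -subr_eq0 -/(Z T) -trmx_eq0; apply/eqP.
apply: mulmx_cV_eq0 => x; apply: dot_eq0; apply/eqP; rewrite eq_le dot_ge0 andbT.
have := Zn x; rewrite qformN oppr_ge0 qformE -mulmxA dot_adj.
by [].
Qed.

(** Sharing the quadratic term between both factors, [Ricc(X) = G X + X G' + R] with
    [G = A - X S / 2]; the source is then [R >= 0]. *)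
Lemma riccati_psd A R S Q X T : psd_cone R -> S^T = S -> psd_cone Q ->
  ode_solution (fun=> ricc A R S) Q X -> 0 <= T -> psd_cone (X T).
Proof.
move=> [Rs R0] Ss X0p Xode T0; have Xs t : 0 <= t -> (X t)^T = X t.
  by apply: riccati_sym Xode => //; case: X0p.
have /ode_entrywise[X0E Xc XD] := Xode.
have [c c0 Hc] := gain_bounded A (2^-1 *: S) Xc T0.
apply: (@psd_comparison _ _ X (fun t => ricc A R S (X t))
    (fun t => A - X t *m (2^-1 *: S)) T c) => //.
- by rewrite X0E.
- by move=> t /andP[t0 _]; apply: Xs.
- by move=> t /andP[t0 _]; apply: XD.
- move=> t x /andP[t0 tT].
  by have := Hc t x; rewrite (ltW t0) tT => /(_ isT) /ler_normlP[_].
move=> t x /andP[t0 _]; have Xt := Xs t (ltW t0).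
rewrite qform_ricc// -dot_adj mulmxBl dotDr dotNr -!mulmxA -scalemxAl -scalemxAr dotZr.
by rewrite (dot_adj A) (dot_sym x _ Xt); have := R0 x; lra.
Qed.

(** The differences of [A], [S] and [R] enter with the weights [2 xi], [xi^2] and [1], each at most
    [(1 + xi)^2]. *)
Lemma qform_ricc_sub_le A1 R1 S1 A2 R2 S2 Q x xi : Q^T = Q -> 0 <= xi ->
  l2norm (Q *m x) <= xi * l2norm x ->
  qform (ricc A1 R1 S1 Q - ricc A2 R2 S2 Q) x
  <= (spectral_norm (A1 - A2) + spectral_norm (R1 - R2) + spectral_norm (S1 - S2))
     * (1 + xi) ^+ 2 * dot x x.
Proof.
move=> Qs xi0 Qx; set u := Q *m x in Qx *.
have -> : qform (ricc A1 R1 S1 Q - ricc A2 R2 S2 Q) x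
    = 2 * dot x ((A1 - A2) *m u) - dot u ((S1 - S2) *m u) + qform (R1 - R2) x.
  rewrite !qformB !qform_ricc// -/u !mulmxBl !dotDr !dotNr !(dot_adj A1) !(dot_adj A2).
  ring.
set a := spectral_norm (A1 - A2); set r := spectral_norm (R1 - R2).
set s := spectral_norm (S1 - S2).
have a0 : 0 <= a := spectral_norm_ge0 _.
have r0 : 0 <= r := spectral_norm_ge0 _.
have s0 : 0 <= s := spectral_norm_ge0 _.
have y0 := l2norm_ge0 x; have u0 := l2norm_ge0 u.
have hA : dot x ((A1 - A2) *m u) <= a * (xi * dot x x).
  apply: le_trans (ler_norm _) _; apply: le_trans (bilin_le_spectral _ _ _) _.
  by rewrite ler_wpM2l// -sqr_l2norm expr2 mulrCA ler_wpM2l.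
have hS : - dot u ((S1 - S2) *m u) <= s * (xi ^+ 2 * dot x x).
  rewrite -dotNr -mulNmx; apply: le_trans (ler_norm _) _.
  apply: le_trans (bilin_le_spectral _ _ _) _.
  rewrite spectral_normN ler_wpM2l// -sqr_l2norm -exprMn expr2.
  by rewrite ler_pM.
have hR : qform (R1 - R2) x <= r * dot x x.
  by apply: le_trans (ler_norm _) _; apply: qform_le_spectral.
have d0 := dot_ge0 x.
have -> : (a + r + s) * (1 + xi) ^+ 2 * dot x x = 2 * (a * (xi * dot x x))
   + s * (xi ^+ 2 * dot x x) + r * dot x x
   + (a * (dot x x * (1 + xi ^+ 2)) + r * (dot x x * (2 * xi + xi ^+ 2))
     + s * (dot x x * (1 + 2 * xi))) by ring.
have : 0 <= a * (dot x x * (1 + xi ^+ 2)) + r * (dot x x * (2 * xi + xi ^+ 2))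
     + s * (dot x x * (1 + 2 * xi)).
  by rewrite !addr_ge0 ?mulr_ge0 ?addr_ge0 ?exprn_ge0 ?mulr_ge0.
lra.
Qed.

End RiccatiTrajectories.

(** * Bounds for one trajectory and comparison of two *)

Section Perturbation.
Context {K : realType} {n : nat}.
Implicit Types (A R S P Q : 'M[K]_n) (X : K -> 'M[K]_n) (x : 'cV[K]_n) (t T : K).

(** The two-sided Loewner condition at [alpha = 1/2], read on forms. *)
Definition form_comparable (M N : 'M[K]_n) : Prop :=
  psd_cone N /\ forall x, qform M x <= 2 * qform N x /\ qform N x <= 2 * qform M x.

Definition near_system (eps : K) A R S A1 R1 S1 : Prop :=
  [/\ spectral_norm (A1 - A) <= eps, form_comparable R R1 & form_comparable S S1].

Lemma form_comparable_refl M : psd_cone M -> form_comparable M M.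
Proof. by move=> Mp; split=> // x; case: Mp => _ /(_ x); split; lra. Qed.

Lemma near_system_refl (eps : K) A R S : 0 <= eps -> psd_cone R -> psd_cone S ->
  near_system eps A R S A R S.
Proof.
move=> e0 Rp Sp; split; try exact: form_comparable_refl.
rewrite subrr; apply: spectral_norm_le => // x.
by rewrite mul0mx [l2norm 0]l2normE dot0r sqrtr0 mulr_ge0 ?l2norm_ge0.
Qed.

(** The solution of [m' = - lambda (m - c)] with [m 0 = c + m0]: the limit is [c] and the transient
    amplitude is [m0]. *)
Definition decay (m0 c lambda t : K) := c + m0 * expR (- lambda * t).

Lemma is_derive_decay m0 c lambda t :
  is_derive t 1 (decay m0 c lambda) (- lambda * (decay m0 c lambda t - c)).
Proof.
have h := is_derive_expRM (- lambda) t.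
have -> : - lambda * (decay m0 c lambda t - c)
    = 0 + m0 *: (- lambda * expR (- lambda * t)) :> K.
  by rewrite /decay -[RHS]/(0 + m0 * _); ring.
have -> : decay m0 c lambda = cst c + m0 *: (fun s => expR (- lambda * s)).
  by apply/funext.
exact: is_deriveD.
Qed.

Lemma decay_continuous m0 c lambda :
  {within [set t : K | 0 <= t], continuous (decay m0 c lambda)}.
Proof.
apply: continuous_subspaceT => t; apply: differentiable_continuous.
by apply/derivable1_diffP; have [] := is_derive_decay m0 c lambda t.
Qed.

(* With the gain [P], the form of [m P - X] solves a linear equation whose
   source is nonnegative as soon as [m' = - lambda (m - c)]; the dissipation
   comes from [(A - P S) P + P (A - P S)' = - R - P S P]. *)
Lemma riccati_bound A R S P A1 R1 S1 Q X (p rho m0 T : K) :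
  R^T = R -> S^T = S -> psd_cone P -> ricc A R S P = 0 -> 0 < p -> 0 < rho ->
  spectral_norm P <= p -> (forall x, rho * dot x x <= qform R x) ->
  near_system (rho / (4 * p)) A R S A1 R1 S1 ->
  ode_solution (fun=> ricc A1 R1 S1) Q X -> psd_cone Q -> 0 <= m0 ->
  (forall x, qform Q x <= m0 * qform P x) -> 0 <= T ->
  forall x, qform (X T) x <=
    decay m0 (8 * (spectral_norm S * p ^+ 2 + spectral_norm R) / rho)
      (rho / (4 * p)) T * qform P x.
Proof.
move=> Rs Ss Pp PE p0 rho0 Ple rhoR [A1e [R1p RR1] [S1p SS1]] Xode Qp m00 Qm0 T0.
have [Ps P0] := Pp; have [R1s _] := R1p; have [S1s S10] := S1p.
(* [c] makes [c rho / 4] equal to [2 (|S| p^2 + |R|)], a bound for the source [P S1 P + R1];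
   [lambda] makes [lambda P <= rho / 4]. *)
set c := 8 * _ / rho; set lambda := rho / (4 * p).
have c0 : 0 <= c.
  apply: divr_ge0; last exact: ltW.
  by rewrite mulr_ge0// addr_ge0 ?mulr_ge0 ?spectral_norm_ge0 ?exprn_ge0// ltW.
have Xp t : 0 <= t -> psd_cone (X t) by apply: riccati_psd Xode.
have /ode_entrywise[XE Xc XD] := Xode.
set m := decay m0 c lambda.
pose dV t := (- lambda * (m t - c) *: P + m t *: (0 : 'M[K]_n)) - ricc A1 R1 S1 (X t).
have mc t : c <= m t by rewrite lerDl mulr_ge0 ?expR_ge0.
suff : psd_cone (m T *: P - X T).
  by move=> [_ h] x; have := h x; rewrite qformB qformZ subr_ge0.
apply: (@psd_comparison _ _ (fun t => m t *: P - X t) dV (fun=> A1 - P *m S1)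
    T (entry_sum (A1 - P *m S1))) => //.
- split=> [|x]; first by rewrite linearB linearZ /= Ps; have [-> _] := Xp 0 (lexx 0).
  rewrite XE qformB qformZ /m /decay mulr0 expR0 mulr1 subr_ge0 mulrDl.
  by rewrite (le_trans (Qm0 x))// lerDr mulr_ge0.
- apply: entrywise_continuousD; last exact: entrywise_continuousN.
  apply: entrywise_continuousZ; first exact: decay_continuous.
  exact: entrywise_continuous_cst.
- by move=> t /andP[t0 _]; rewrite linearB linearZ /= Ps; have [-> _] := Xp t t0.
- move=> t /andP[t0 _]; apply: entrywise_deriveD.
    apply: entrywise_deriveZ; first exact: is_derive_decay.
    exact: entrywise_derive_cst.
  by apply: entrywise_deriveN; exact: XD.
- move=> t x _; apply: le_trans (ler_norm _) _; exact: qform_le_entry_sum.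
move=> t x /andP[t0 _]; have [Xs _] := Xp t (ltW t0).
set u := P *m x; set w := X t *m x; set a := A1^T *m x.
have uw : dot w (S1 *m u) = dot u (S1 *m w) by rewrite dot_sym// dotC.
have E1 : dot ((A1 - P *m S1)^T *m x) ((m t *: P - X t) *m x)
    = m t * dot a u - dot a w - m t * dot u (S1 *m u) + dot u (S1 *m w).
  rewrite linearB /= trmx_mul S1s Ps !mulmxBl -scalemxAl -/u -/w -/a -mulmxA -/u.
  rewrite !dot_lin -(dot_sym u u S1s) -(dot_sym u w S1s); ring.
have E2 : qform (dV t) x = - lambda * (m t - c) * qform P x
    - (2 * dot a w - dot w (S1 *m w) + qform R1 x).
  by rewrite /dV qformB qformD !qformZ qform0 mulr0 addr0 qform_ricc.
rewrite E1 E2.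
have Pric : 2 * dot (A^T *m x) u - dot u (S *m u) + qform R x = 0.
  by rewrite /u -qform_ricc// PE qform0.
have ua : dot a u = dot (A^T *m x) u + dot x ((A1 - A) *m u).
  by rewrite mulmxBl dotDr dotNr !dot_adj -/a; ring.
have ule : l2norm u <= p * l2norm x.
  by apply: le_trans (l2norm_mulmx_le _ _) _; rewrite ler_wpM2r ?l2norm_ge0.
have uu : dot u u <= p ^+ 2 * dot x x.
  by rewrite -!sqr_l2norm -exprMn ler_pXn2r ?nnegrE ?mulr_ge0 ?l2norm_ge0// ltW.
have d0 := dot_ge0 x.
have hA : dot x ((A1 - A) *m u) <= rho / 4 * dot x x.
  apply: le_trans (ler_norm _) _; apply: le_trans (bilin_le_spectral _ _ _) _.
  have -> : rho / 4 * dot x x = (rho / (4 * p)) * (l2norm x * (p * l2norm x)).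
    by rewrite -sqr_l2norm; field; rewrite gt_eqF.
  by rewrite ler_pM ?mulr_ge0 ?spectral_norm_ge0 ?l2norm_ge0// ler_wpM2l ?l2norm_ge0.
have hS : qform S1 u <= 2 * (spectral_norm S * (p ^+ 2 * dot x x)).
  have [_ /le_trans] := SS1 u; apply; rewrite ler_pM2l//.
  apply: le_trans (ler_norm _) _; apply: le_trans (qform_le_spectral _ _) _.
  by rewrite ler_wpM2l ?spectral_norm_ge0.
have hR : qform R1 x <= 2 * (spectral_norm R * dot x x).
  have [_ /le_trans] := RR1 x; apply; rewrite ler_pM2l//.
  by apply: le_trans (ler_norm _) _; apply: qform_le_spectral.
have hPx : lambda * qform P x <= rho / 4 * dot x x.
  have -> : rho / 4 * dot x x = lambda * (p * dot x x).
    by rewrite /lambda; field; rewrite gt_eqF.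
  rewrite ler_wpM2l//; first by rewrite divr_ge0 ?mulr_ge0// ltW.
  apply: le_trans (ler_norm _) _; apply: le_trans (qform_le_spectral _ _) _.
  by rewrite ler_wpM2r.
have hc : c * (rho / 4 * dot x x)
    = 2 * (spectral_norm S * (p ^+ 2 * dot x x)) + 2 * (spectral_norm R * dot x x).
  by rewrite /c; field; rewrite gt_eqF.
have wu := S10 (w - u).
have wuE : qform S1 (w - u) = dot w (S1 *m w) - 2 * dot u (S1 *m w) + dot u (S1 *m u).
  by rewrite qformE mulmxBr !dot_lin uw; ring.
have [SS _] := SS1 u; rewrite !qformE in SS hS.
have rx := rhoR x.
(* Dissipation of [P] under the perturbed gain: [S <= 2 S1] absorbs the quadratic term of the
   fixed-point equation, [R] contributes [rho], and [A1 - A] costs at most [rho / 2]. *)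
have h1 : 0 <= 2 * dot u (S1 *m u) - 2 * dot a u - rho / 2 * dot x x by lra.
have m0' : 0 <= m t := le_trans c0 (mc t).
have h2 := mulr_ge0 m0' h1.
have h3 : (m t - c) * (lambda * qform P x) <= (m t - c) * (rho / 4 * dot x x).
  by rewrite ler_wpM2l// subr_ge0.
have h4 : 0 <= m t * (rho / 4 * dot x x) by rewrite mulr_ge0// mulr_ge0// divr_ge0// ltW.
rewrite wuE in wu; lra.
Qed.

(** The parameter change is evaluated at [X1] only. With [m = a + b expR (- mu t)], the term [m R2]
    must cover this source and the loss [mu b expR (- mu t) X2]; matching constant and exponential
    parts separately gives the conditions on [d0] and [d1]. *)
Lemma riccati_compare A1 R1 S1 A2 R2 S2 Q1 Q2 X1 X2 (rho beta d0 d1 a b mu T : K) :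
  psd_cone R1 -> psd_cone S1 -> psd_cone R2 -> psd_cone S2 ->
  psd_cone Q1 -> psd_cone Q2 ->
  ode_solution (fun=> ricc A1 R1 S1) Q1 X1 ->
  ode_solution (fun=> ricc A2 R2 S2) Q2 X2 ->
  (forall x, rho * dot x x <= qform R2 x) ->
  (forall t x, 0 <= t -> qform (X2 t) x <= beta * dot x x) ->
  (forall t x, 0 < t -> qform (ricc A1 R1 S1 (X1 t) - ricc A2 R2 S2 (X1 t)) x
     <= decay d1 d0 mu t * dot x x) ->
  0 <= a -> 0 <= b -> 0 <= mu -> d0 <= a * rho -> d1 <= b * (rho - mu * beta) ->
  (forall x, qform (Q1 - Q2) x <= (a + b) * qform Q2 x) -> 0 <= T ->
  forall x, qform (X1 T - X2 T) x <= decay b a mu T * qform (X2 T) x.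
Proof.
move=> R1p S1p R2p S2p Q1p Q2p X1ode X2ode rhoR Xbeta HD a0 b0 mu0 d0a d1b Q12 T0.
have [S1s _] := S1p; have [S2s S20] := S2p.
have X1p t : 0 <= t -> psd_cone (X1 t) by apply: riccati_psd X1ode.
have X2p t : 0 <= t -> psd_cone (X2 t) by apply: riccati_psd X2ode.
have /ode_entrywise[X1E X1c X1D] := X1ode.
have /ode_entrywise[X2E X2c X2D] := X2ode.
set m := decay b a mu.
have [L L0 HL] := gain_bounded A2 S2 X2c T0.
pose dV t := (- mu * (m t - a) *: X2 t + m t *: ricc A2 R2 S2 (X2 t))
  - (ricc A1 R1 S1 (X1 t) - ricc A2 R2 S2 (X2 t)).
suff : psd_cone (m T *: X2 T - (X1 T - X2 T)).
  by move=> [_ h] x; have := h x; rewrite (qformB (m T *: _)) qformZ subr_ge0.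
have Vs t : 0 <= t -> (m t *: X2 t - (X1 t - X2 t))^T = m t *: X2 t - (X1 t - X2 t).
  by move=> t0; rewrite !linearB linearZ /=; have [-> _] := X1p t t0; have [-> _] := X2p t t0.
apply: (@psd_comparison _ _ (fun t => m t *: X2 t - (X1 t - X2 t)) dV
    (fun t => A2 - X2 t *m S2) T L) => //.
- split=> [|x]; first exact: Vs.
  by rewrite X1E X2E (qformB (m 0 *: _)) qformZ /m /decay mulr0 expR0 mulr1 subr_ge0.
- apply: entrywise_continuousD.
    by apply: entrywise_continuousZ => //; exact: decay_continuous.
  apply: entrywise_continuousN; apply: entrywise_continuousD => //.
  exact: entrywise_continuousN.
- by move=> t /andP[t0 _]; apply: Vs.
- move=> t /andP[t0 _]; apply: entrywise_deriveD.
    by apply: entrywise_deriveZ; [exact: is_derive_decay|exact: X2D].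
  apply: entrywise_deriveN; apply: entrywise_deriveD; first exact: X1D.
  by apply: entrywise_deriveN; exact: X2D.
- move=> t x /andP[t0 tT].
  by have := HL t x; rewrite (ltW t0) tT => /(_ isT) /ler_normlP[_].
move=> t x /andP[t0 _]; have [X1s _] := X1p t (ltW t0); have [X2s X20] := X2p t (ltW t0).
set u := X2 t *m x; set w := X1 t *m x; set g := A2^T *m x.
have uw : dot w (S2 *m u) = dot u (S2 *m w) by rewrite dot_sym// dotC.
have E1 : dot ((A2 - X2 t *m S2)^T *m x) ((m t *: X2 t - (X1 t - X2 t)) *m x)
    = (m t + 1) * (dot g u - dot u (S2 *m u)) - dot g w + dot u (S2 *m w).
  rewrite linearB /= trmx_mul S2s X2s !mulmxBl -scalemxAl -/u -/w -/g -mulmxA -/u.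
  rewrite !dot_lin -(dot_sym u u S2s) -(dot_sym u w S2s); ring.
have E2 : qform (dV t) x = - mu * (m t - a) * qform (X2 t) x
    + (m t + 1) * (2 * dot g u - dot u (S2 *m u) + qform R2 x)
    - (2 * dot g w - dot w (S2 *m w) + qform R2 x)
    - qform (ricc A1 R1 S1 (X1 t) - ricc A2 R2 S2 (X1 t)) x.
  rewrite /dV !qformB qformD !qformZ (qform_ricc A2 R2 S2 x X1s) -/w -/g.
  by rewrite (qform_ricc A2 R2 S2 x X2s) -/u -/g; ring.
rewrite E1 E2.
have uwE : qform S2 (w - u) = dot w (S2 *m w) - 2 * dot u (S2 *m w) + dot u (S2 *m u).
  by rewrite qformE mulmxBr !dot_lin uw; ring.
have := S20 (w - u); rewrite uwE => h1.
have := S20 u; rewrite qformE => h2.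
have h3 := HD t x t0; rewrite /decay in h3.
set e := expR (- mu * t) in h3; have e0 : 0 <= e := expR_ge0 _.
have mE : m t = a + b * e by [].
have d0' := dot_ge0 x.
have h4 : mu * (b * e) * qform (X2 t) x <= mu * (b * e) * (beta * dot x x).
  by rewrite ler_wpM2l ?mulr_ge0// Xbeta// ltW.
have h5 : (a + b * e) * (rho * dot x x) <= (a + b * e) * qform R2 x.
  by rewrite ler_wpM2l ?addr_ge0 ?mulr_ge0.
have h6 : d0 * dot x x <= a * rho * dot x x by rewrite ler_wpM2r.
have h7 : d1 * (e * dot x x) <= b * (rho - mu * beta) * (e * dot x x).
  by rewrite ler_wpM2r// mulr_ge0.
have h8 : 0 <= (a + b * e) * dot u (S2 *m u) by rewrite mulr_ge0 ?addr_ge0 ?mulr_ge0.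
rewrite mE; lra.
Qed.

End Perturbation.

(** * Two-sided distance estimate with explicit constants *)

Section Distance.
Context {K : realType} {n : nat} (A R S P : 'M[K]_n) (p rho : K).
Context (R_psd : psd_cone R) (S_psd : psd_cone S) (P_psd : psd_cone P).
Context (PE : ricc A R S P = 0) (p_gt0 : 0 < p) (rho_gt0 : 0 < rho).
Context (P_le : spectral_norm P <= p).
Context (R_ge : forall x, rho * dot x x <= qform R x).
Implicit Types (Q : 'M[K]_n) (X : K -> 'M[K]_n) (x : 'cV[K]_n) (t T : K).

(** The limiting constant of [riccati_bound] times [p], because [P <= p]; no initial condition
    enters. *)
Definition asymptotic_bound : K :=
  8 * (spectral_norm S * p ^+ 2 + spectral_norm R) / rho * p.

(** The first rate is that of [riccati_bound]. The second keeps
    [mu (asymptotic_bound + q) <= rho / 4], half of the lower bound [rho / 2] on nearby [R]. *)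
Definition decay_rate q : K :=
  Num.min (rho / (4 * p)) (rho / (4 * (asymptotic_bound + q + 1))).

Definition limit_factor : K := 2 * (1 + asymptotic_bound) ^+ 2 * asymptotic_bound / rho.

(** Collects, per unit of perturbation, the coefficient of the exponential in [(a + b e) (c + q e)],
    with [e^2] bounded by [e]. *)
Definition transient_factor q : K :=
  2 * ((1 + asymptotic_bound) ^+ 2 * q
    + 2 * (2 * (1 + asymptotic_bound) * q + q ^+ 2) * (asymptotic_bound + q)) / rho.

Let c := asymptotic_bound.

Lemma asymptotic_bound_ge0 : 0 <= c.
Proof.
apply: mulr_ge0; last exact: ltW; apply: divr_ge0; last exact: ltW.
by rewrite mulr_ge0// addr_ge0 ?mulr_ge0 ?spectral_norm_ge0 ?exprn_ge0// ltW.
Qed.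

Lemma decay_rate_gt0 q : 0 <= q -> 0 < decay_rate q.
Proof.
move=> q0; have c0 := asymptotic_bound_ge0.
by rewrite lt_min !divr_gt0 ?mulr_gt0// ltr_wpDl ?addr_ge0.
Qed.

Lemma riccati_trajectory_le A1 R1 S1 Q X m0 t x :
  near_system (rho / (4 * p)) A R S A1 R1 S1 ->
  psd_cone Q -> ode_solution (fun=> ricc A1 R1 S1) Q X -> 0 <= m0 ->
  (forall x, qform Q x <= m0 * qform P x) -> 0 <= t ->
  qform (X t) x <= decay (m0 * p) c (decay_rate (m0 * p)) t * dot x x.
Proof.
move=> near Qp Xode m00 Qm t0.
have [Rs _] := R_psd; have [Ss _] := S_psd; have [_ P0] := P_psd.
apply: le_trans (riccati_bound Rs Ss P_psd PE p_gt0 rho_gt0 P_le R_ge near Xode Qp m00 Qm t0 x) _.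
have Px : qform P x <= p * dot x x.
  apply: le_trans (ler_norm _) _; apply: le_trans (qform_le_spectral _ _) _.
  by rewrite ler_wpM2r ?dot_ge0.
apply: le_trans (ler_wpM2l _ Px) _.
  apply: addr_ge0; last by rewrite mulr_ge0 ?expR_ge0.
  by have := asymptotic_bound_ge0; rewrite /c /asymptotic_bound pmulr_lge0.
rewrite mulrA ler_wpM2r ?dot_ge0// /decay mulrDl lerD2l mulrAC ler_wpM2l//.
  by rewrite mulr_ge0// ltW.
by rewrite ler_expR !mulNr lerN2 ler_wpM2r// ge_min lexx.
Qed.

Local Opaque asymptotic_bound.

Lemma limit_factor_ge0 : 0 <= limit_factor.
Proof.
apply: divr_ge0; last exact: ltW.
by rewrite mulr_ge0 ?asymptotic_bound_ge0// mulr_ge0 ?exprn_ge0 ?addr_ge0 ?asymptotic_bound_ge0.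
Qed.

Lemma transient_factor_ge0 q : 0 <= q -> 0 <= transient_factor q.
Proof.
move=> q0; have c0 := asymptotic_bound_ge0.
have c1 : 0 <= 1 + c by rewrite addr_ge0.
rewrite /transient_factor -/c divr_ge0 ?(ltW rho_gt0)// mulr_ge0//.
have d1 : 0 <= (1 + c) ^+ 2 := exprn_ge0 _ c1.
have d2 : 0 <= q ^+ 2 := exprn_ge0 _ q0.
have d3 : 0 <= 2 * (1 + c) * q + q ^+ 2 by rewrite addr_ge0// mulr_ge0// mulr_ge0.
by rewrite addr_ge0 ?mulr_ge0// addr_ge0.
Qed.

Lemma riccati_one_sided A1 R1 S1 A2 R2 S2 Q1 Q2 X1 X2 (m0 k gamma T : K) x :
  near_system (rho / (4 * p)) A R S A1 R1 S1 ->
  near_system (rho / (4 * p)) A R S A2 R2 S2 ->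
  gamma = spectral_norm (A1 - A2) + spectral_norm (R1 - R2)
    + spectral_norm (S1 - S2) ->
  psd_cone Q1 -> psd_cone Q2 ->
  ode_solution (fun=> ricc A1 R1 S1) Q1 X1 ->
  ode_solution (fun=> ricc A2 R2 S2) Q2 X2 ->
  0 <= m0 -> (forall x, qform Q1 x <= m0 * qform P x) ->
  (forall x, qform Q2 x <= m0 * qform P x) ->
  0 <= k -> (forall x, qform (Q1 - Q2) x <= k * qform Q2 x) -> 0 <= T ->
  qform (X1 T - X2 T) x <=
    (limit_factor * gamma
     + (transient_factor (m0 * p) * gamma + k * (c + m0 * p))
       * expR (- decay_rate (m0 * p) * T)) * dot x x.
Proof.
move=> near1 near2 gammaE Q1p Q2p X1ode X2ode m00 Q1m Q2m k0 Q12 T0.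
have [_ [R1p _] [S1p _]] := near1; have [_ [R2p RR2] [S2p _]] := near2.
set q := m0 * p; set mu := decay_rate q.
have q0 : 0 <= q by rewrite mulr_ge0// ltW.
have c0 : 0 <= c := asymptotic_bound_ge0.
have mu0 : 0 < mu := decay_rate_gt0 q0.
have g0 : 0 <= gamma by rewrite gammaE !addr_ge0 ?spectral_norm_ge0.
have X1le t y : 0 <= t -> qform (X1 t) y <= decay q c mu t * dot y y.
  by move=> t0; apply: riccati_trajectory_le near1 Q1p X1ode m00 Q1m t0.
have X2le t y : 0 <= t -> qform (X2 t) y <= decay q c mu t * dot y y.
  by move=> t0; apply: riccati_trajectory_le near2 Q2p X2ode m00 Q2m t0.
clearbody q.
have e1 t : 0 <= t -> expR (- mu * t) <= 1.
  by move=> t0; rewrite -(expR0 K) ler_expR mulNr oppr_le0 mulr_ge0// ltW.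
have dec0 t : 0 <= decay q c mu t.
  by apply: addr_ge0 => //; apply: mulr_ge0 => //; exact: expR_ge0.
(* For [e <= 1], [(1 + c + q e)^2 <= k0' + k1 e]: the constant and transient parts of the source. *)
pose k0' := (1 + c) ^+ 2; pose k1 := 2 * (1 + c) * q + q ^+ 2.
have k00 : 0 <= k0' by rewrite exprn_ge0// addr_ge0.
have k10 : 0 <= k1 by rewrite addr_ge0 ?exprn_ge0// mulr_ge0// mulr_ge0// addr_ge0.
(* Chosen to meet the conditions of [riccati_compare] with [rho / 2] for [rho] and
   [mu beta <= rho / 4]; the summand [k] covers the initial gap. *)
pose a := 2 * (gamma * k0') / rho; pose b := 4 * (gamma * k1) / rho + k.
have r0 := ltW rho_gt0; have gk0 := mulr_ge0 g0 k00; have gk1 := mulr_ge0 g0 k10.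
have a0 : 0 <= a by apply: divr_ge0 => //; exact: mulr_ge0.
have gk10 : 0 <= 4 * (gamma * k1) / rho by apply: divr_ge0 => //; exact: mulr_ge0.
have b0 : 0 <= b by exact: addr_ge0.
have mubeta : mu * (c + q) <= rho / 4.
  have cq1 : 0 < c + q + 1 by rewrite ltr_wpDl ?addr_ge0.
  have : mu * (c + q + 1) <= rho / 4.
    have -> : rho / 4 = rho / (4 * (c + q + 1)) * (c + q + 1) by field; rewrite gt_eqF.
    by rewrite ler_wpM2r ?(ltW cq1)// ge_min lexx orbT.
  by rewrite mulrDr mulr1; lra.
have HD t y : 0 < t -> qform (ricc A1 R1 S1 (X1 t) - ricc A2 R2 S2 (X1 t)) y
    <= decay (gamma * k1) (gamma * k0') mu t * dot y y.
  move=> t0; have [S1s _] := S1p.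
  have [X1s X10] := riccati_psd R1p S1s Q1p X1ode (ltW t0).
  have yle : l2norm (X1 t *m y) <= decay q c mu t * l2norm y.
    by apply: l2norm_sym_le => // z; rewrite ger0_norm ?X1le// ltW.
  apply: le_trans (qform_ricc_sub_le _ _ _ _ _ _ X1s (dec0 t) yle) _.
  rewrite -gammaE ler_wpM2r ?dot_ge0// /decay -mulrA -mulrDr ler_wpM2l// /k0' /k1.
  have := e1 t (ltW t0); have := expR_ge0 (- mu * t); set e := expR _ => ee0 ee1.
  have h : q ^+ 2 * (e * e) <= q ^+ 2 * (e * 1) by rewrite !ler_wpM2l ?exprn_ge0.
  by lra.
have [_ X20] := riccati_psd R2p (proj1 S2p) Q2p X2ode T0.
have R2ge y : rho / 2 * dot y y <= qform R2 y.
  by have [h _] := RR2 y; have := R_ge y; lra.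
have X2beta t y : 0 <= t -> qform (X2 t) y <= (c + q) * dot y y.
  move=> t0; apply: le_trans (X2le t y t0) _.
  by rewrite ler_wpM2r ?dot_ge0// lerD2l ler_piMr// e1.
have h1 : gamma * k0' <= a * (rho / 2).
  have -> : a * (rho / 2) = gamma * k0' by rewrite /a; field; rewrite gt_eqF.
  exact: lexx.
have h2 : gamma * k1 <= b * (rho / 2 - mu * (c + q)).
  have -> : gamma * k1 = 4 * (gamma * k1) / rho * (rho / 4) by field; rewrite gt_eqF.
  by apply: ler_pM => //; rewrite ?lerDl//; lra.
have h3 y : qform (Q1 - Q2) y <= (a + b) * qform Q2 y.
  have [_ Q20] := Q2p; apply: le_trans (Q12 y) _.
  by rewrite ler_wpM2r// /b addrA lerDr addr_ge0.
have := riccati_compare R1p S1p R2p S2p Q1p Q2p X1ode X2ode R2ge X2beta HD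
  a0 b0 (ltW mu0) h1 h2 h3 T0 x.
move=> /le_trans; apply; have dec0' : 0 <= decay b a mu T.
  by apply: addr_ge0 => //; apply: mulr_ge0 => //; exact: expR_ge0.
apply: le_trans (ler_wpM2l dec0' (X2le T x T0)) _.
rewrite mulrA ler_wpM2r ?dot_ge0// /decay.
have := e1 T T0; have := expR_ge0 (- mu * T); set e := expR _ => ee0 ee1.
have h : b * q * (e * e) <= b * q * (e * 1) by rewrite !ler_wpM2l ?mulr_ge0.
have -> : limit_factor * gamma = a * c.
  by rewrite /limit_factor /a /k0' -/c; field; rewrite gt_eqF.
have -> : transient_factor q * gamma + k * (c + q) = a * q + b * (c + q).
  by rewrite /transient_factor /a /b /k0' /k1 -/c; field; rewrite gt_eqF.
by lra.
Qed.

(** The one-sided estimate with the systems exchanged bounds the form from below. The gap [k] allows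
    distinct initial conditions, as for two fixed points. *)
Lemma riccati_distance A1 R1 S1 A2 R2 S2 Q1 Q2 X1 X2 (m0 k gamma T : K) :
  near_system (rho / (4 * p)) A R S A1 R1 S1 ->
  near_system (rho / (4 * p)) A R S A2 R2 S2 ->
  gamma = spectral_norm (A1 - A2) + spectral_norm (R1 - R2)
    + spectral_norm (S1 - S2) ->
  psd_cone Q1 -> psd_cone Q2 ->
  ode_solution (fun=> ricc A1 R1 S1) Q1 X1 ->
  ode_solution (fun=> ricc A2 R2 S2) Q2 X2 ->
  0 <= m0 -> (forall x, qform Q1 x <= m0 * qform P x) ->
  (forall x, qform Q2 x <= m0 * qform P x) ->
  0 <= k -> (forall x, qform (Q1 - Q2) x <= k * qform Q2 x) ->
  (forall x, qform (Q2 - Q1) x <= k * qform Q1 x) -> 0 <= T ->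
  spectral_norm (X1 T - X2 T) <=
    limit_factor * gamma
    + (transient_factor (m0 * p) * gamma + k * (c + m0 * p))
      * expR (- decay_rate (m0 * p) * T).
Proof.
move=> near1 near2 gammaE Q1p Q2p X1ode X2ode m00 Q1m Q2m k0 Q12 Q21 T0.
have [_ [R1p _] [[S1s _] _]] := near1; have [_ [R2p _] [[S2s _] _]] := near2.
have [X1s _] := riccati_psd R1p S1s Q1p X1ode T0.
have [X2s _] := riccati_psd R2p S2s Q2p X2ode T0.
have q0 : 0 <= m0 * p by rewrite mulr_ge0// ltW.
have gammaE' : gamma = spectral_norm (A2 - A1) + spectral_norm (R2 - R1)
    + spectral_norm (S2 - S1).
  by rewrite gammaE -(spectral_normN (A2 - A1)) -(spectral_normN (R2 - R1))
    -(spectral_normN (S2 - S1)) !opprB.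
have g0 : 0 <= gamma by rewrite gammaE !addr_ge0 ?spectral_norm_ge0.
apply: spectral_norm_sym_le; first by rewrite linearB /= X1s X2s.
  have lg := mulr_ge0 limit_factor_ge0 g0.
  have tg := mulr_ge0 (transient_factor_ge0 q0) g0.
  have kg := mulr_ge0 k0 (addr_ge0 asymptotic_bound_ge0 q0).
  exact: addr_ge0 lg (mulr_ge0 (addr_ge0 tg kg) (expR_ge0 _)).
move=> x; rewrite ler_norml -lerNl -qformN opprB; apply/andP; split.
  exact: riccati_one_sided near2 near1 gammaE' Q2p Q1p X2ode X1ode m00 Q2m Q1m k0 Q21 T0.
exact: riccati_one_sided near1 near2 gammaE Q1p Q2p X1ode X2ode m00 Q1m Q2m k0 Q12 T0.
Qed.

End Distance.

(** * Changing exponential rates and letting time tend to infinity *)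

Section ExponentialAbsorption.
Context {K : realType}.
Implicit Types (B mu nu t y a : K).

Lemma mul_expRN_le1 B : 0 <= B -> B * expR (- B) <= 1.
Proof.
move=> B0; have eB := expR_gt0 B.
by rewrite expRN ler_pdivrMr// mul1r; have := expR_ge1Dx B; lra.
Qed.

(* The left side is at most 1 from time [B / mu] on, so the rate on the right
   is arbitrary. *)
Lemma expR_rate_change B mu nu t : 0 <= B -> 0 < mu -> 0 < nu -> 0 <= t ->
  B * expR (- mu * t) <= 1 + expR (- (nu * t)) * (B * expR (nu * (B / mu))).
Proof.
move=> B0 mu0 nu0 t0; rewrite mulrCA -expRD.
have [tB|Bt] := leP t (B / mu).
  rewrite ler_wpDl// ler_wpM2l// ler_expR.
  have : 0 <= mu * t by rewrite mulr_ge0// ltW.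
  have : nu * t <= nu * (B / mu) by rewrite ler_wpM2l// ltW.
  by lra.
rewrite ler_wpDr ?mulr_ge0 ?expR_ge0//.
apply: le_trans (mul_expRN_le1 B0); rewrite ler_wpM2l// ler_expR mulNr lerN2.
by rewrite mulrC -ler_pdivrMr// ltW.
Qed.

Lemma expR_decay_limit y a B mu : 0 <= B -> 0 < mu ->
  (forall t, 0 <= t -> y <= a + B * expR (- mu * t)) -> y <= a.
Proof.
move=> B0 mu0 h; apply/ler_addgt0Pr => e e0.
have [BE|Bn0] := eqVneq B 0.
  by have := h 0 (lexx 0); rewrite BE mul0r addr0; lra.
have Bp : 0 < B by rewrite lt_def Bn0.
(* At this time the exponent is [- B / e], and [y exp(-y) <= 1] at [y = B / e] makes the transient
   at most [e]. *)
apply: le_trans (h (B / (e * mu)) _) _; first by rewrite divr_ge0 ?mulr_ge0// ltW.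
rewrite lerD2l; have -> : - mu * (B / (e * mu)) = - (B / e).
  by field; rewrite !gt_eqF.
have := mul_expRN_le1 (divr_ge0 B0 (ltW e0)).
by rewrite mulrAC ler_pdivrMr// mul1r.
Qed.

End ExponentialAbsorption.

(** * Nominal data and the perturbation theorem *)

Lemma psd_gram (K : realType) (r r' : nat) (C : 'M[K]_(r', r)) (Sigma : 'M[K]_r') :
  posdef Sigma -> psd_cone (C^T *m invmx Sigma *m C).
Proof.
move=> Sigma_pd; have [Ss _] := Sigma_pd; have [_ Sp] := posdef_psd Sigma_pd.
have [Su|nSu] := boolP (Sigma \in unitmx); last first.
  (* On a singular matrix [invmx] is the identity, so the form is that of [Sigma] at [C x]. *)
  rewrite /invmx (negbTE nSu); split=> [|x]; first by rewrite !trmx_mul trmxK Ss mulmxA.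
  by have := Sp (C *m x); rewrite /qform trmx_mul !mulmxA.
split=> [|x]; first by rewrite !trmx_mul trmxK trmx_inv Ss mulmxA.
have := Sp (invmx Sigma *m (C *m x)).
by rewrite /qform !trmx_mul trmx_inv Ss !mulmxA mulmxKV.
Qed.

Lemma loewner_comparable (K : realType) (n : nat) (M N : 'M[K]_n) :
  psd_cone N -> loewner_le (2^-1 *: M) N -> loewner_le N (2^-1^-1 *: M) ->
  form_comparable M N.
Proof.
move=> Np [_ lo] [_ up]; split=> // x; have := lo x; have := up x.
by rewrite !qformB !qformZ invrK; split; lra.
Qed.

Theorem theorem2p6 (K : realType) (r r' : nat)
  (A R S sqrtR P : 'M[K]_r) (C : 'M[K]_(r', r)) (Sigma : 'M[K]_r')
  (phi : K -> 'M[K]_r -> 'M[K]_r) (nu : K)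
  (R_posdef : posdef R) (Sigma_posdef : posdef Sigma)
  (SE : S = C^T *m invmx Sigma *m C)
  (sqrtR_psd : psd_cone sqrtR) (sqrtRE : sqrtR *m sqrtR = R)
  (AR_controllable : controllable A sqrtR)
  (AC_observable : observable A C)
  (phi_flow : riccati_flow A R S phi)
  (P_fixpoint : riccati_fixpoint A R S P)
  (nu_rate : stability_rate A S phi nu) :
  exists (chi1 : K -> K) (chi2 : K -> K -> K),
  forall (Pi : set (cone_map K r)) (Api Rpi Spi : cone_map K r -> 'M[K]_r),
    uniform_compact Pi ->
    (forall pi, Pi pi -> psd_cone (Rpi pi) /\ psd_cone (Spi pi)) ->
    continuity_condition A R S Pi Api Rpi Spi ->
    exists2 delta : K, 0 < delta &
      forall pi, near_id Pi delta pi ->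
        (forall phi_pi : K -> 'M[K]_r -> 'M[K]_r,
           riccati_flow (Api pi) (Rpi pi) (Spi pi) phi_pi ->
           forall (t : K) (Q : 'M[K]_r), 0 <= t -> psd_cone Q ->
             spectral_norm (phi_pi t Q - phi t Q)
               <= (chi1 delta
                   + expR (- (4 * nu * t)) * chi2 delta (spectral_norm Q))
                  * perturbation_size A R S Api Rpi Spi pi)
        /\
        (forall P_pi : 'M[K]_r,
           riccati_fixpoint (Api pi) (Rpi pi) (Spi pi) P_pi ->
           spectral_norm (P_pi - P)
             <= chi1 delta * perturbation_size A R S Api Rpi Spi pi).
Proof.
have R_psd := posdef_psd R_posdef.
have S_psd : psd_cone S by rewrite SE; exact: psd_gram.
have [P_posdef PE] := P_fixpoint; have P_psd := posdef_psd P_posdef.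
have [rho rho0 R_ge] := posdef_coercive R_posdef.
have [p0 p00 P_ge] := posdef_coercive P_posdef.
have nu0 : 0 < nu by case: nu_rate.
pose p := spectral_norm P + 1.
have pp : 0 < p by rewrite ltr_wpDl ?spectral_norm_ge0.
have Pp : spectral_norm P <= p by rewrite lerDl.
have le_P Q q x : spectral_norm Q <= q -> qform Q x <= q / p0 * qform P x.
  move=> Qq; have q0 := le_trans (spectral_norm_ge0 Q) Qq.
  apply: le_trans (ler_norm _) _; apply: le_trans (qform_le_spectral _ _) _.
  apply: (@le_trans _ _ (q * dot x x)); first by rewrite ler_wpM2r ?dot_ge0.
  by rewrite -mulrA ler_wpM2l// mulrC ler_pdivlMr// mulrC.
pose chi := limit_factor R S p rho.
pose mu q := decay_rate R S p rho (q / p0 * p).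
pose B q := transient_factor R S p rho (q / p0 * p).
have chi0 : 0 <= chi := limit_factor_ge0 R S pp rho0.
(* Both are fixed by the nominal data before the family is introduced. The [1] and the exponential
   factor come from [expR_rate_change] at rate [4 nu]. *)
exists (fun=> chi + 1), (fun _ q => B q * expR (4 * nu * (B q / mu q))).
move=> Pi Api Rpi Spi _ psdPi cont.
set eps := rho / (4 * p); have eps0 : 0 < eps by rewrite divr_gt0 ?mulr_gt0.
(* The continuity condition is used at [alpha = 1/2] and at the tolerance [eps], truncated at 1 to
   be admissible. *)
have eps1 : 0 < Num.min eps 1 <= 1 by rewrite lt_min eps0 ltr01 ge_min lexx orbT.
have half : 0 < (2^-1 : K) < 1 by rewrite invr_gt0 ltr0n invf_lt1// ltr1n.
have [delta delta0 Hd] := cont _ _ eps1 half.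
exists delta => // pi pi_near.
have [Rpi_psd Spi_psd] := psdPi _ (proj1 pi_near).
have [[Slo Sup] [Rlo Rup] A_le] := Hd _ pi_near.
have near_pi : near_system eps A R S (Api pi) (Rpi pi) (Spi pi).
  split; [|exact: loewner_comparable|exact: loewner_comparable].
  rewrite -spectral_normN opprB; apply: le_trans A_le _.
  by rewrite ge_min lexx.
have near0 : near_system eps A R S A R S by apply: near_system_refl; rewrite // ltW.
set gamma := perturbation_size _ _ _ _ _ _ _.
have gamma0 : 0 <= gamma by rewrite !addr_ge0 ?spectral_norm_ge0.
split=> [phi_pi phi_pi_flow t Q t0 Qp|P_pi [P_pi_posdef P_piE]].
  set q := spectral_norm Q; have q0 : 0 <= q := spectral_norm_ge0 _.
  have qp0 : 0 <= q / p0 := divr_ge0 q0 (ltW p00).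
  have qpp0 : 0 <= q / p0 * p := mulr_ge0 qp0 (ltW pp).
  have Qle x : qform Q x <= q / p0 * qform P x by exact: le_P.
  have QQ (x : 'cV[K]_r) : qform (Q - Q) x <= 0 * qform Q x by rewrite subrr qform0 mul0r.
  apply: le_trans (riccati_distance R_psd S_psd P_psd PE pp rho0 Pp R_ge near_pi near0
    erefl Qp Qp (phi_pi_flow Q Qp) (phi_flow Q Qp) qp0 Qle Qle (lexx 0) QQ QQ t0) _.
  rewrite mul0r addr0 -/(perturbation_size A R S Api Rpi Spi pi) -/gamma.
  rewrite -/chi -/(B q) -/(mu q) [B q * gamma * _]mulrAC -mulrDl ler_wpM2r// -addrA lerD2l.
  apply: expR_rate_change => //; [exact: transient_factor_ge0|exact: decay_rate_gt0|].
  by rewrite mulr_gt0.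
have P_pi_psd := posdef_psd P_pi_posdef.
have [c1 c10 P_pi_ge] := posdef_coercive P_pi_posdef.
(* [q] and the gap [k] below depend on [P_pi], which is harmless: they affect only the transient,
   which vanishes as [t] grows. *)
pose q := spectral_norm P_pi + spectral_norm P.
have q0 : 0 <= q by rewrite addr_ge0 ?spectral_norm_ge0.
have qp0 : 0 <= q / p0 := divr_ge0 q0 (ltW p00).
have P_pi_le x : qform P_pi x <= q / p0 * qform P x.
  by apply: le_P; rewrite lerDl spectral_norm_ge0.
have P_le x : qform P x <= q / p0 * qform P x.
  by apply: le_P; rewrite lerDr spectral_norm_ge0.
(* The first term bounds [P_pi] by a multiple of [P], the second [P] by a multiple of [P_pi]. *)
pose k := q / p0 + q / c1.
have k1 : 0 <= q / c1 := divr_ge0 q0 (ltW c10).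
have k0 : 0 <= k := addr_ge0 qp0 k1.
have P_piP x : qform (P_pi - P) x <= k * qform P x.
  rewrite qformB mulrDl; have := P_pi_le x; have [_ /(_ x)] := P_psd => Px.
  by have := mulr_ge0 k1 Px; lra.
have PP_pi x : qform (P - P_pi) x <= k * qform P_pi x.
  have Px : qform P x <= q / c1 * qform P_pi x.
    apply: le_trans (ler_norm _) _; apply: le_trans (qform_le_spectral _ _) _.
    apply: (@le_trans _ _ (q * dot x x)).
      by rewrite ler_wpM2r ?dot_ge0// lerDr spectral_norm_ge0.
    by rewrite -mulrA ler_wpM2l// mulrC ler_pdivlMr// mulrC.
  rewrite qformB mulrDl; have [_ /(_ x)] := P_pi_psd => P_pix.
  by have := mulr_ge0 qp0 P_pix; lra.
have X1ode : ode_solution (fun=> ricc (Api pi) (Rpi pi) (Spi pi)) P_pi (fun=> P_pi).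
  exact: ode_solution_cst.
have X2ode : ode_solution (fun=> ricc A R S) P (fun=> P) by exact: ode_solution_cst.
have qpp0 : 0 <= q / p0 * p := mulr_ge0 qp0 (ltW pp).
apply: (@le_trans _ _ (chi * gamma)); last by rewrite ler_wpM2r// lerDl.
apply: (@expR_decay_limit _ _ _ (B q * gamma + k * (asymptotic_bound R S p rho + q / p0 * p)) (mu q)).
- have Bg : 0 <= B q * gamma := mulr_ge0 (transient_factor_ge0 R S pp rho0 qpp0) gamma0.
  exact: addr_ge0 Bg (mulr_ge0 k0 (addr_ge0 (asymptotic_bound_ge0 R S pp rho0) qpp0)).
- exact: decay_rate_gt0.
move=> t t0.
exact: (riccati_distance R_psd S_psd P_psd PE pp rho0 Pp R_ge near_pi near0
  erefl P_pi_psd P_psd X1ode X2ode qp0 P_pi_le P_le k0 P_piP PP_pi t0).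
Qed.
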